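(* Let $n\ge1$ and $R\ge1$ be integers, $\vec x=(x_1,\dots,x_R)$ and $\vec y=(y_1,\dots,y_R)$ complex numbers, and $X=\mathrm{diag}(X_1,\dots,X_n)$, $Y=\mathrm{diag}(Y_1,\dots,Y_n)$ complex diagonal matrices with $x_i\ne X_k$ and $y_i\neq Y_k$ for all $i,k$. Then for all permutations $\pi,\pi'\in\Sigma_R$, $$W^{(n)}_{\pi,\pi'}(\vec x,\vec y,X,Y)=\Big(\mathcal M^{(R)}(\vec x,\vec y,X_n,Y_n)\,\mathcal M^{(R)}(\vec x,\vec y,X_{n-1},Y_{n-1})\cdots\mathcal M^{(R)}(\vec x,\vec y,X_1,Y_1)\Big)_{\pi,\pi'} .$$
   Context: $\Sigma_R$ is the group of permutations of $\{1,\dots,R\}$. $\mathcal M^{(R)}(\vec x,\vec y,\xi,\eta)$ is the $R!\times R!$ matrix indexed by pairs of permutations in $\Sigma_R$ with entries $$\mathcal M^{(R)}_{\pi,\rho}(\vec x,\vec y,\xi,\eta)=\prod_{i=1}^R\Big(\delta_{\pi(i),\rho(i)}+\frac1{(x_i-\xi)(y_{\pi(i)}-\eta)}\Big).$$ For $\pi,\pi'\in\Sigma_R$, decompose $\{1,\dots,R\}$ into the cycles of $i\mapsto\pi'^{-1}(\pi(i))$; write the $k$-th cycle ($k=1,\dots,p$), of length $R_k$, as $(i_{k,1},i_{k,2},\dots,i_{k,R_k})$ with $i_{k,l+1}=\pi'^{-1}(\pi(i_{k,l}))$ (cyclically), and put $j_{k,l}=\pi(i_{k,l})$. For $n\times n$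 complex matrices $A,B$ define $$F_{\pi,\pi'}(\vec x,\vec y,A,B):=\prod_{k=1}^p\Big(\delta_{R_k,1}+\operatorname{Tr}\prod_{l=1}^{R_k}\frac1{x_{i_{k,l}}-A}\,\frac1{y_{j_{k,l}}-B}\Big)$$ (product over $l$ ordered from left to right; $\frac{1}{x-A}=(x\,\mathrm{Id}-A)^{-1}$). $T_n$ is the space of strictly upper triangular complex $n\times n$ matrices with $dT=\prod_{i<j}d\,\mathrm{Re}T_{ij}\,d\,\mathrm{Im}T_{ij}$, and $$W^{(n)}_{\pi,\pi'}(\vec x,\vec y,X,Y):=\frac{\int_{T_n}dT\,e^{-\operatorname{Tr}TT^\dagger}F_{\pi,\pi'}(\vec x,\vec y,X+T,Y+T^\dagger)}{\int_{T_n}dT\,e^{-\operatorname{Tr}TT^\dagger}}$$ (for $n=1$ this is $F_{\pi,\pi'}(\vec x,\vec y,X_1,Y_1)$). Note that $\frac1{x-(X+T)}$ and $\frac{1}{y-(Y+T^\dagger)}$ are polynomial in the entries of $T$, $T^\dagger$. *)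

(* Defs.v *)
From HB Require Import structures.
From mathcomp Require Import all_boot all_order all_fingroup all_algebra.
From mathcomp Require Import complex.
From mathcomp Require Import all_classical all_reals all_analysis.

Set Implicit Arguments.
Unset Strict Implicit.
Unset Printing Implicit Defensive.

Import Order.TTheory GRing.Theory Num.Theory.
Import numFieldNormedType.Exports.

Local Open Scope classical_set_scope.
Local Open Scope ring_scope.
Local Open Scope complex_scope.
Local Open Scope sesquilinear_scope.

(* Stated separately because the library's canonical sigma-finite structure on
   [m1 \x m2] only fires for subprobability measures. *)
Lemma sigma_finite_product d1 d2 (T1 : measurableType d1)
    (T2 : measurableType d2) (K : realType)
    (m1 : {sigma_finite_measure set T1 -> \bar K})
    (m2 : {sigma_finite_measure set T2 -> \bar K}) :
  sigma_finite setT (m1 \x m2)%E.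
Proof.
have /sigma_finiteP[F [TF ndF Foo]] := sigma_finiteT m1.
have /sigma_finiteP[G [TG ndG Goo]] := sigma_finiteT m2.
exists (fun n => F n `*` G n).
  rewrite -setXTT TF TG predeqE => -[x y]; split.
    move=> [/= [n _ Fnx] [k _ Gky]]; exists (maxn n k) => //; split.
    - by move: x Fnx; exact/subsetPset/ndF/leq_maxl.
    - by move: y Gky; exact/subsetPset/ndG/leq_maxr.
  by move=> [n _ []/= ? ?]; split; exists n.
move=> k; have [? ?] := Foo k; have [? ?] := Goo k.
split; first exact: measurableX.
by rewrite product_measure1E// lte_mul_pinfty// ge0_fin_numE.
Qed.

(* The library has binary product measures only: the [n]-fold product [mu ^ n]
   on [n.-tuple T] is obtained by transporting [mu \x mu ^ n] along
   [(x, t) |-> x :: t].  Its characterisation on boxes is [tuple_measure_box]. *)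
Section tuple_measure_step.
Context d (T : measurableType d) (K : realType).
Variable mu : {sigma_finite_measure set T -> \bar K}.
Variables (n : nat) (nu : {sigma_finite_measure set (n.-tuple T) -> \bar K}).

Definition tuple_pcons (p : T * n.-tuple T) : n.+1.-tuple T :=
  [the n.+1.-tuple T of p.1 :: p.2].

Lemma measurable_tuple_pcons : measurable_fun setT tuple_pcons.
Proof. exact: measurable_cons. Qed.

Definition tuple_measureS : set (n.+1.-tuple T) -> \bar K :=
  pushforward (mu \x nu)%E tuple_pcons.

Let tuple_measureS0 : tuple_measureS set0 = 0%E.
Proof. by rewrite /tuple_measureS /pushforward preimage_set0 measure0. Qed.

Let tuple_measureS_ge0 A : (0 <= tuple_measureS A)%E.
Proof. by rewrite /tuple_measureS /pushforward; exact: measure_ge0. Qed.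

Let tuple_measureS_sigma_additive : semi_sigma_additive tuple_measureS.
Proof.
move=> F mF tF mUF; rewrite /tuple_measureS /pushforward preimage_bigcup.
apply: measure_semi_sigma_additive.
- by move=> i; rewrite -[X in measurable X]setTI; exact: measurable_tuple_pcons.
- apply/trivIsetP => i j _ _ ij; rewrite -preimage_setI.
  by move/trivIsetP : tF => -> //; rewrite preimage_set0.
- rewrite -preimage_bigcup -[X in measurable X]setTI.
  exact: measurable_tuple_pcons.
Qed.

HB.instance Definition _ := isMeasure.Build _ _ _ tuple_measureS
  tuple_measureS0 tuple_measureS_ge0 tuple_measureS_sigma_additive.

Let tuple_measureS_sigma_finite : sigma_finite setT tuple_measureS.
Proof.
have [F TF Foo] := sigma_finite_product mu nu.
pose g (t : n.+1.-tuple T) : T * n.-tuple T := (thead t, [tuple of behead t]).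
have gK : cancel tuple_pcons g.
  by move=> [x t]; rewrite /g /tuple_pcons; congr (_, _); exact: val_inj.
have mg : measurable_fun setT g.
  apply/measurable_fun_pairP; split; first exact: measurable_tnth.
  exact: measurable_behead.
exists (fun k => g @^-1` F k).
  by rewrite -preimage_bigcup -TF preimage_setT.
move=> k; have [mF Fk] := Foo k; split.
  by rewrite -[X in measurable X]setTI; exact: mg.
rewrite /tuple_measureS /pushforward -comp_preimage.
by rewrite (_ : g \o tuple_pcons = id)//; apply/funext => p; exact: gK.
Qed.

HB.instance Definition _ := Measure_isSigmaFinite.Build _ _ _ tuple_measureS
  tuple_measureS_sigma_finite.

End tuple_measure_step.

Fixpoint tuple_measure d (T : measurableType d) (K : realType)
    (mu : {sigma_finite_measure set T -> \bar K}) (n : nat) :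
    {sigma_finite_measure set (n.-tuple T) -> \bar K} :=
  match n with
  | 0 => [the {sigma_finite_measure set _ -> \bar K} of
          \d_([tuple] : 0.-tuple T)]
  | n'.+1 => [the {sigma_finite_measure set _ -> \bar K} of
              tuple_measureS mu (tuple_measure mu n')]
  end.

Lemma tuple_measure_box d (T : measurableType d) (K : realType)
    (mu : {sigma_finite_measure set T -> \bar K}) (n : nat)
    (A : 'I_n -> set T) : (forall i, measurable (A i)) ->
  tuple_measure mu n [set t | forall i, A i (tnth t i)] =
  (\prod_(i < n) mu (A i))%E.
Proof.
elim: n A => [|n IHn] A mA /=.
  by rewrite big_ord0 diracE mem_set// => -[].
rewrite big_ord_recl /= -IHn//= /tuple_measureS /pushforward.
rewrite -product_measure1E//; last first.
  have -> : [set t : n.-tuple T | forall i, A (lift ord0 i) (tnth t i)] =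
      \bigcap_(i in [set: 'I_n]) (@tnth n T ^~ i) @^-1` A (lift ord0 i).
    by apply/seteqP; split=> t /= h i; [move=> _|]; exact: h.
  apply: fin_bigcap_measurable => // i _.
  by rewrite -[X in measurable X]setTI; exact: measurable_tnth.
congr (_ _); apply/seteqP; split=> -[x t] /=.
  move=> h; split; first exact: (h ord0).
  by move=> i; have := h (lift ord0 i); rewrite tnthS.
move=> [h0 h] i; case: (unliftP ord0 i) => [j ->|-> //].
by rewrite tnthS; exact: h.
Qed.

Definition lebesgue_measure2 {K : realType} :
    set (measurableTypeR K * measurableTypeR K) -> \bar K :=
  (@lebesgue_measure K \x @lebesgue_measure K)%E.

HB.instance Definition _ (K : realType) := Measure.on (@lebesgue_measure2 K).
HB.instance Definition _ (K : realType) := Measure_isSigmaFinite.Build _ _ _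
  (@lebesgue_measure2 K)
  (sigma_finite_product (@lebesgue_measure K) (@lebesgue_measure K)).

Definition cintegral d (T : measurableType d) (K : realType)
    (mu : {measure set T -> \bar K}) (f : T -> K[i]) : K[i] :=
  (\int[mu]_t complex.Re (f t)) +i* (\int[mu]_t complex.Im (f t)).

(* Strictly upper triangular matrices are parametrised by the pairs
   [(Re T_ij, Im T_ij)], [i < j], so that [triangular_measure] is
   [\prod_(i < j) d(Re T_ij) d(Im T_ij)]; for [n = 1] it is the unit mass at
   the empty tuple. *)
Definition upper_index (n : nat) := {ij : 'I_n * 'I_n | (ij.1 < ij.2)%N}.

Definition triangular_mx (K : realType) (n : nat)
    (t : #|{: upper_index n}|.-tuple (measurableTypeR K * measurableTypeR K)) :
    'M[K[i]]_n :=
  \matrix_(i, j)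
    if insub (i, j) is Some ij then
      let z := tnth t (enum_rank (ij : upper_index n)) in z.1 +i* z.2
    else 0.

Definition triangular_measure (K : realType) (n : nat) :
    {sigma_finite_measure
      set (#|{: upper_index n}|.-tuple (measurableTypeR K * measurableTypeR K))
      -> \bar K} :=
  tuple_measure (@lebesgue_measure2 K) #|{: upper_index n}|.

(* [complex.Re] only changes the type: the trace of [T *m T ^t*] is real. *)
Definition gauss_weight (K : realType) (n : nat) (T : 'M[K[i]]_n) : K :=
  expR (- complex.Re (\tr (T *m T ^t*))).

Definition resolvent (K : realType) (n : nat) (z : K[i]) (A : 'M[K[i]]_n) :
    'M[K[i]]_n :=
  invmx (z%:M - A).

Definition cycle_step (R : nat) (p p' : 'S_R) (i : 'I_R) : 'I_R :=
  (p'^-1)%g (p i).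

Definition cycle_factor (K : realType) (R n : nat) (p p' : 'S_R)
    (x y : 'I_R -> K[i]) (A B : 'M[K[i]]_n) (i : 'I_R) : K[i] :=
  let f := cycle_step p p' in
  (fingraph.order f i == 1)%:R +
  \tr (\prod_(l < fingraph.order f i)
         (resolvent (x (iter l f i)) A * resolvent (y (p (iter l f i))) B)).

Lemma cycle_factor_step (K : realType) (R n : nat) (p p' : 'S_R)
    (x y : 'I_R -> K[i]) (A B : 'M[K[i]]_n) (i : 'I_R) :
  cycle_factor p p' x y A B (cycle_step p p' i) =
  cycle_factor p p' x y A B i.
Proof.
have finj : injective (cycle_step p p') by move=> j k /perm_inj/perm_inj.
rewrite /cycle_factor (_ : fingraph.order _ (cycle_step p p' i) =
    fingraph.order (cycle_step p p') i).
  congr (_ + _); case E: (fingraph.order _ i) => [|k].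
    by rewrite !big_ord0.
  rewrite big_ord_recr big_ord_recl /= -mulmxE mxtrace_mulC mulmxE.
  congr (\tr (_ * _)).
    by rewrite -iterSr -E iter_order.
  by apply: eq_bigr => l _; rewrite -!iterSr.
by apply/eq_card => j; rewrite !inE -same_fconnect1.
Qed.

(* [froots] picks one starting point in each cycle; by [cycle_factor_step] the
   choice is irrelevant. *)
Definition F (K : realType) (R n : nat) (p p' : 'S_R) (x y : 'I_R -> K[i])
    (A B : 'M[K[i]]_n) : K[i] :=
  \prod_(i in froots (cycle_step p p')) cycle_factor p p' x y A B i.

Definition W (K : realType) (R n : nat) (p p' : 'S_R) (x y : 'I_R -> K[i])
    (X Y : 'M[K[i]]_n) : K[i] :=
  cintegral (triangular_measure K n)
    (fun t => let T := triangular_mx t in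
       (gauss_weight T)%:C * F p p' x y (X + T) (Y + T ^t*))
  / (\int[triangular_measure K n]_t gauss_weight (triangular_mx t))%:C.

Definition calM_entry (K : realType) (R : nat) (x y : 'I_R -> K[i])
    (xi eta : K[i]) (p q : 'S_R) : K[i] :=
  \prod_(i < R) ((p i == q i)%:R + ((x i - xi) * (y (p i) - eta))^-1).

(* Matrices are indexed by ordinals: permutations are numbered by [enum_rank]. *)
Definition calM (K : realType) (R : nat) (x y : 'I_R -> K[i]) (xi eta : K[i]) :
    'M[K[i]]_#|{: 'S_R}| :=
  \matrix_(a, b) calM_entry x y xi eta (enum_val a) (enum_val b).

(* Main.v *)
(* Split the last column [v] off the triangular matrix [T].  Each product
   [(x_i - A)^-1 (y_j - B)^-1] is then the same product for the smaller matrices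
   plus a rank-one term [u * w z], with [u = 1 / ((x_i - X_n) (y_j - Y_n))] and
   with [w], [z] affine in [v], [v^*].  Written as a sum over index assignments
   [k : 'I_R -> 'I_n + {None}] instead of a product of traces over cycles,
   [F p p'] expands over the set [S] of indices where the rank-one term is
   chosen.  Averaging over [v] with Wick's theorem produces a sum over the
   permutations fixing the complement of [S], and these are exactly the
   permutations [r] that survive in the expansion of the entry
   [\prod_i ((p i == r i) + u)] of the matrix [calM], each with the coefficient
   [F r p'] of the smaller matrices.  Hence each column contributes one factor
   [calM], and for [n = 0] only [(p == p')] is left.

   The Gaussian average is handled algebraically, as the linear functional
   [gauss_expect] on polynomials in the entries of [T] and their conjugates; the
   integral only enters through the moments [a! * (a == b)] of
   [z ^+ a * (z^* ) ^+ b], obtained by integration by parts. *)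

Require Import Defs.
From HB Require Import structures.
From mathcomp Require Import all_boot all_order all_fingroup all_algebra.
From mathcomp Require Import complex.
From mathcomp Require Import all_classical all_reals all_analysis.
From mathcomp Require Import measurable_realfun ring lra.

Set Implicit Arguments.
Unset Strict Implicit.
Unset Printing Implicit Defensive.

Import Order.TTheory GRing.Theory Num.Theory.
Local Open Scope ring_scope.

(** * Permanents and sums over cycles *)

Section Permanent.
Variable C : comNzRingType.

Lemma sum_perm_lift n (i0 j0 : 'I_n.+1) (P : 'S_n.+1 -> C) :
  \sum_(s : 'S_n.+1 | s i0 == j0) P s = \sum_(s : 'S_n) P (lift_perm i0 j0 s).
Proof.
(* The default [k] is never reached, since [s (lift i0 k)] differs from [s i0]. *)
pose h (s : 'S_n.+1) k := odflt k (unlift (s i0) (s (lift i0 k))).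
have hE (s : 'S_n.+1) k : lift (s i0) (h s k) = s (lift i0 k).
  rewrite /h; case: unliftP => [k' -> //|/perm_inj/eqP].
  by rewrite eq_sym (negbTE (neq_lift i0 k)).
have h_inj s : injective (h s).
  by move=> k k' /(congr1 (lift (s i0))); rewrite !hE => /perm_inj/lift_inj.
rewrite (reindex_onto (lift_perm i0 j0) (fun s => perm (h_inj s))) => [|s /eqP si0].
  apply: eq_bigl => s; rewrite lift_perm_id eqxx; apply/eqP/permP => k.
  by apply: (@lift_inj _ j0); rewrite permE -{1}(lift_perm_id i0 j0 s) hE lift_perm_lift.
apply/permP => k; case: (unliftP i0 k) => [k' ->|->]; last by rewrite lift_perm_id si0.
by rewrite lift_perm_lift permE -si0 hE.
Qed.

(** Laplace expansion of a permanent along its first row. *)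
Lemma permanent_row n (f : 'I_n.+1 -> 'I_n.+1 -> C) :
  \sum_(s : 'S_n.+1) \prod_i f i (s i) =
  \sum_j f ord0 j * \sum_(s : 'S_n) \prod_i f (lift ord0 i) (lift j (s i)).
Proof.
rewrite (partition_big (fun s : 'S_n.+1 => s ord0) predT) //=.
apply: eq_bigr => j _; rewrite sum_perm_lift big_distrr /=.
apply: eq_bigr => s _; rewrite big_ord_recl lift_perm_id; congr (_ * _).
by apply: eq_bigr => i _; rewrite lift_perm_lift.
Qed.

(* [E (z ^+ a * (z^* ) ^+ b)] for a standard complex Gaussian [z]. *)
Definition cgauss_moment (a b : nat) : C := if a == b then a`!%:R else 0.

(** A permutation contributes only if it matches every letter of the word [c] with an equal letter
    of [d]; a letter occurring [a] times in both can be matched in [a!] ways. This is Wick's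
    theorem: pairings on the left, moments on the right. *)
Lemma permanent_delta (V : finType) n (c d : 'I_n -> V) :
  \sum_(s : 'S_n) \prod_i ((c i == d (s i))%:R : C) =
  \prod_x cgauss_moment (\sum_i (c i == x)) (\sum_i (d i == x)).
Proof.
elim: n c d => [|n IHn] c d.
  rewrite (big_pred1 1%g) => [|s]; last by apply/esym/eqP/permP => -[].
  by rewrite big_ord0 big1// => x _; rewrite /cgauss_moment !big_ord0.
have dE j x : (\sum_i (d i == x))%N =
    ((d j == x) + \sum_i (d (lift j i) == x))%N.
  rewrite (bigD1 j)//=; congr addn.
  rewrite (reindex_omap (lift j) (unlift j)) /=.
    by apply: eq_bigl => i; rewrite liftK eqxx eq_sym neq_lift.
  by move=> i; rewrite eq_sym => /unlift_some[k -> ->].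
rewrite (permanent_row (fun i j => (c i == d j)%:R : C)).
(* The common value of the minors for columns [j] with [d j = c ord0]: both words lose the same
   letter, so equality of counts may be tested on the full words. *)
pose m := \prod_x (if (\sum_i (c i == x) == \sum_i (d i == x))%N
   then ((\sum_(i < n) (c (lift ord0 i) == x))%N)`!%:R else 0 : C).
transitivity (\sum_j ((c ord0 == d j)%:R * m)).
  apply: eq_bigr => j _; have [cd|] := eqVneq; last by rewrite !mul0r.
  rewrite !mul1r (IHn (fun i => c (lift ord0 i)) (fun i => d (lift j i))).
  apply: eq_bigr => x _; rewrite /cgauss_moment big_ord_recl (dE j) -cd.
  by rewrite eqn_add2l.
rewrite -mulr_suml.
have [H|/forallPn[x Hx]] :=
    boolP [forall x, \sum_i (c i == x) == \sum_i (d i == x)]%N; last first.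
  rewrite /m (bigD1 x)// [RHS](bigD1 x)//= /cgauss_moment !(negbTE Hx).
  by rewrite !mul0r mulr0.
rewrite /m (bigD1 (c ord0))//= [RHS](bigD1 (c ord0))//= /cgauss_moment.
(* The number of such columns is the multiplicity of [c ord0], the factor missing from its
   factorial. *)
rewrite (forallP H) mulrA; congr (_ * _).
  rewrite -natr_sum [X in X%:R * _](_ : _ = \sum_i (c i == c ord0))%N.
    by rewrite big_ord_recl eqxx add1n -natrM -factS.
  by rewrite (eqP (forallP H _)); apply: eq_bigr => i _; rewrite eq_sym.
apply: eq_bigr => x xc; rewrite (forallP H) big_ord_recl.
by rewrite eq_sym (negbTE xc).
Qed.

End Permanent.

(** * Products of traces over cycles as sums over index assignments *)

Section CycleTrace.
Variable C : comNzRingType.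

(** An entry of the product of the matrices [M 0], ..., [M (m - 1)], in this order. *)
Fixpoint chain (J : finType) (M : nat -> J -> J -> C) m a b : C :=
  if m is m'.+1 then \sum_c chain M m' a c * M m' c b else (a == b)%:R.

Lemma sum_ffun_recr (J : finType) n (P : {ffun 'I_n.+1 -> J} -> C) :
  \sum_g P g =
  \sum_(g : {ffun 'I_n -> J}) \sum_a P [ffun i => oapp g a (unlift ord_max i)].
Proof.
rewrite pair_bigA /= (reindex (fun q : {ffun 'I_n -> J} * J =>
  [ffun i => oapp q.1 q.2 (unlift ord_max i)] : {ffun 'I_n.+1 -> J})) //.
exists (fun g : {ffun 'I_n.+1 -> J} =>
  ([ffun i => g (lift ord_max i)], g ord_max)) => [[g a] _|g _] /=.
  rewrite ffunE unlift_none; congr pair.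
  by apply/ffunP => i; rewrite !ffunE liftK.
apply/ffunP => i; rewrite ffunE.
by case: unliftP => [j ->|->] //=; rewrite ffunE.
Qed.

(** Summing over the interior vertices of a path multiplies the matrices. The endpoint weight [P] is
    arbitrary so that the induction can absorb the last step into it. *)
Lemma chain_sum (J : finType) (M : nat -> J -> J -> C) m (P : J -> J -> C) :
  \sum_(g : {ffun 'I_m.+1 -> J})
    (\prod_(l < m) M l (g (widen_ord (leqnSn m) l)) (g (lift ord0 l)))
     * P (g ord0) (g ord_max) =
  \sum_a \sum_b chain M m a b * P a b.
Proof.
elim: m P => [|m IHm] P.
  rewrite sum_ffun_recr (big_pred1 [ffun i : 'I_0 => False_rect _
    (notF (ltn_ord i))]) /=; last first.
    by move=> g; apply/esym/eqP/ffunP => -[].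
  apply: eq_bigr => a _; rewrite big_ord0 mul1r !ffunE.
  rewrite (_ : ord0 = ord_max); last exact: val_inj.
  rewrite unlift_none /= (bigD1 a)//= eqxx mul1r big1 ?addr0// => b ba.
  by rewrite eq_sym (negbTE ba) mul0r.
rewrite sum_ffun_recr.
transitivity (\sum_(g : {ffun 'I_m.+1 -> J})
    (\prod_(l < m) M l (g (widen_ord (leqnSn m) l)) (g (lift ord0 l)))
     * (\sum_a M m (g ord_max) a * P (g ord0) a)).
  apply: eq_bigr => g _; rewrite big_distrr /=; apply: eq_bigr => a _.
  rewrite big_ord_recr /= mulrA; congr (_ * _ * P _ _).
  - apply: eq_bigr => l _; rewrite !ffunE.
    rewrite (_ : widen_ord _ (widen_ord _ l) =
       lift ord_max (widen_ord (leqnSn m) l)); last first.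
      by apply/val_inj; rewrite /= /bump leqNgt ltnS (ltnW (ltn_ord l)).
    rewrite (_ : lift ord0 (widen_ord _ l) =
       lift ord_max (lift ord0 l)); last first.
      by apply/val_inj; rewrite /= /bump leq0n add1n leqNgt !ltnS ltn_ord.
    by rewrite !liftK.
  - rewrite !ffunE (_ : widen_ord _ ord_max = lift ord_max ord_max); last first.
      by apply/val_inj; rewrite /= /bump ltnn.
    rewrite liftK (_ : lift ord0 ord_max = ord_max) ?unlift_none//.
    exact/val_inj.
  - rewrite ffunE (_ : ord0 = lift ord_max ord0) ?liftK//.
    exact/val_inj.
  - by rewrite ffunE unlift_none.
rewrite (IHm (fun b c => \sum_a M m c a * P b a)).
apply: eq_bigr => a _.
under eq_bigr => b _ do rewrite big_distrr /=.
rewrite exchange_big /=; apply: eq_bigr => b _.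
by rewrite big_distrl /=; apply: eq_bigr => c _; rewrite mulrA.
Qed.

Lemma chain_cycle (J : finType) (M : nat -> J -> J -> C) m :
  \sum_(g : {ffun 'I_m.+1 -> J}) \prod_(l < m.+1) M l (g l) (g (ordS l)) =
  \sum_a chain M m.+1 a a.
Proof.
(* The factor closing the cycle serves as the endpoint weight. *)
transitivity (\sum_a \sum_b chain M m a b * M m b a) => //.
rewrite -(chain_sum M m (fun a b => M m b a)).
apply: eq_bigr => g _; rewrite big_ord_recr /=; congr (_ * _).
  apply: eq_bigr => l _; congr (M _ (g _) (g _)); apply/val_inj => //=.
  by rewrite modn_small// ltnS.
by congr (M _ (g _) (g _)); apply/val_inj; rewrite //= modnn.
Qed.

Variables (T J : finType) (f : T -> T) (j0 : J).
Hypothesis finj : injective f.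

Let froot_eq i j : (froot f i == froot f j) = fconnect f i j.
Proof. exact: root_connect (fconnect_sym finj) i j. Qed.

(** An assignment amounts to independent restrictions to the cycles of [f]; a restriction is encoded
    as a full assignment with the filler [j0] outside its cycle. The rest is distributivity. *)
Lemma sum_over_orbits (P : T -> {ffun T -> J} -> C) :
  (forall c (k k' : {ffun T -> J}),
    (forall i, froot f i == c -> k i = k' i) -> P c k = P c k') ->
  \sum_(k : {ffun T -> J}) \prod_(c in froots f) P c k =
  \prod_(c in froots f)
    \sum_(k : {ffun T -> J} | [forall (i | froot f i != c), k i == j0]) P c k.
Proof.
move=> Ploc.
rewrite (big_distr_big_dep [ffun=> j0]) /=.
rewrite (reindex (fun k : {ffun T -> J} => [ffun c =>
  if c \in froots f then [ffun i => if froot f i == c then k i else j0]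
  else [ffun=> j0]] : {ffun T -> {ffun T -> J}})) /=; last first.
  exists (fun h : {ffun T -> {ffun T -> J}} => [ffun i => h (froot f i) i]).
    move=> k _; apply/ffunP => i; rewrite !ffunE.
    by rewrite [_ \in _](roots_root (fconnect_sym finj)) !ffunE eqxx.
  move=> h /pfamilyP[/supportP hs hQ]; apply/ffunP => c; rewrite !ffunE.
  case: ifP => [cr|/negbT cr]; last by rewrite hs.
  apply/ffunP => i; rewrite !ffunE; case: eqVneq => [->//|ic].
  by have /forallP/(_ i)/implyP/(_ ic)/eqP := hQ _ cr.
apply: eq_big => [k|k _].
  apply/esym/pfamilyP; split.
    by apply/supportP => c; rewrite ffunE => /negbTE ->.
  move=> c cr; rewrite ffunE cr; apply/forallP => i; apply/implyP => ic.
  by rewrite ffunE (negbTE ic).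
apply: eq_bigr => c cr; apply: Ploc => i ic; rewrite !ffunE cr ffunE.
by rewrite ic.
Qed.

Lemma sum_one_orbit (M : T -> J -> J -> C) c : c \in froots f ->
  \sum_(k : {ffun T -> J} | [forall (i | froot f i != c), k i == j0])
    \prod_(i | froot f i == c) M i (k i) (k (f i)) =
  \sum_a chain (fun l => M (iter l f c)) (fingraph.order f c) a a.
Proof.
move=> /eqP cr; have ordE := orderSpred f c.
rewrite -ordE -chain_cycle ordE.
have rc i : (froot f i == c) = fconnect f c i by rewrite -{1}cr eq_sym froot_eq.
(* [idx i] is the position of [i] on the cycle of [c], undefined elsewhere; it inverts
   [l |-> iter l f c]. *)
pose idx i : option 'I_(fingraph.order f c) :=
  if froot f i == c then insub (findex f c i) else None.
have idxK (l : 'I_(fingraph.order f c)) : idx (iter l f c) = Some l.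
  rewrite /idx rc fconnect_iter findex_iter//.
  case: insubP => [l' _ ll'|]; last by rewrite ltn_ord.
  by congr Some; exact: val_inj.
have idxS i : froot f i == c -> omap (fun l => iter (val l) f c) (idx i) = Some i.
  move=> ic; rewrite /idx ic; case: insubP => [l _ lE|]; last first.
    by rewrite findex_max -?rc.
  by rewrite /= lE iter_findex -?rc.
rewrite (reindex (fun g : {ffun 'I_(fingraph.order f c) -> J} =>
   [ffun i => oapp g j0 (idx i)] : {ffun T -> J})) /=; last first.
  exists (fun k : {ffun T -> J} => [ffun l => k (iter (val l) f c)]).
    by move=> g _; apply/ffunP => l; rewrite !ffunE idxK.
  move=> k /forallP kj; apply/ffunP => i; rewrite !ffunE.
  have [ic|ic] := boolP (froot f i == c); last first.
    by rewrite /idx (negbTE ic) /=; apply/esym/eqP; move/implyP: (kj i); apply.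
  by have := idxS _ ic; case: (idx i) => //= l [<-]; rewrite ffunE.
apply: eq_big => [g|g _].
  by apply/forallP => i; apply/implyP => ic; rewrite ffunE /idx (negbTE ic).
rewrite (reindex_omap (fun l : 'I_(fingraph.order f c) => iter l f c) idx) //.
apply: eq_big => [l|l _].
  by rewrite idxK eqxx andbT rc fconnect_iter.
rewrite !ffunE idxK /=; congr (M _ _ _).
rewrite -iterS; have [lm|ml] := ltnP l.+1 (fingraph.order f c).
  rewrite (_ : ordS l = Ordinal lm) ?(idxK (Ordinal lm))//.
  by apply/val_inj; rewrite /= modn_small.
(* At the last position the successor wraps round to [c]. *)
have lE : l.+1 = fingraph.order f c by apply/eqP; rewrite eqn_leq ml ltn_ord.
rewrite [in LHS]lE iter_order//.
have o0 := fingraph.order_gt0 f c.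
rewrite (_ : ordS l = Ordinal o0) ?(idxK (Ordinal o0))//.
by apply/val_inj; rewrite /= [X in (X %% _)%N]lE modnn.
Qed.

Lemma sum_ffun_cycles (M : T -> J -> J -> C) :
  \sum_(k : {ffun T -> J}) \prod_i M i (k i) (k (f i)) =
  \prod_(c in froots f)
     \sum_a chain (fun l => M (iter l f c)) (fingraph.order f c) a a.
Proof.
transitivity (\sum_(k : {ffun T -> J}) \prod_(c in froots f)
    \prod_(i | froot f i == c) M i (k i) (k (f i))).
  apply: eq_bigr => k _; rewrite (partition_big (froot f) [in froots f]) //=.
  by move=> i _; exact: (roots_root (fconnect_sym finj)).
rewrite (sum_over_orbits (P := fun c k =>
  \prod_(i | froot f i == c) M i (k i) (k (f i)))).
  by apply: eq_bigr => c; exact: sum_one_orbit.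
move=> c k k' kk'; apply: eq_bigr => i ic; congr (M _ _ _); apply: kk' => //.
rewrite -(eqP ic) eq_sym froot_eq; exact: fconnect1.
Qed.

End CycleTrace.

(** * Resolvents of triangular matrices *)

Section Resolvent.
Variable C : fieldType.

(** Block inversion of [z] minus an upper triangular matrix: bordering it by a column [v] and a
    diagonal entry [x] adds to the smaller inverse [A] the column [A v / (z - x)] above the corner
    [1 / (z - x)]. Natural-number indices let the smaller inverse be reused without casts. *)
Fixpoint res_entry (z : C) (X : nat -> C) (t : nat -> nat -> C) n i j : C :=
  if n is m.+1 then
    if (j < m)%N then (if (i < m)%N then res_entry z X t m i j else 0)
    else if (i < m)%N then
      (\sum_(c < m) res_entry z X t m i c * t c m) / (z - X m)
    else (z - X m)^-1
  else 0.

Definition upper_mx n (X : nat -> C) (t : nat -> nat -> C) : 'M[C]_n :=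
  \matrix_(i, j) if i == j then X i else if (i < j)%N then t i j else 0.

Lemma res_entryP z X t n : (forall k, (k < n)%N -> z != X k) ->
  invmx (z%:M - upper_mx n X t) = \matrix_(i, j) res_entry z X t n i j.
Proof.
move=> zX.
(* For square matrices a one-sided inverse suffices; [b] holds the entries of
   [z - upper_mx n X t]. *)
pose b (c j : nat) := if c == j then z - X j else if (c < j)%N then - t c j else 0.
have main : forall i j, (i < n)%N -> (j < n)%N ->
    \sum_(c < n) res_entry z X t n i c * b c j = (i == j)%:R.
  elim: n zX => // m IHm zX i j im jm.
  rewrite big_ord_recr /= ltnn.
  have [{}jm|mj] := ltnP j m.
    rewrite [b m j](_ : _ = 0) ?mulr0 ?addr0; last first.
      by rewrite /b (gtn_eqF jm) (ltnNge m) (ltnW jm).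
    have [{}im|mi] := ltnP i m.
      rewrite -IHm //; last by move=> k km; apply: zX; exact: ltnW.
      by apply: eq_bigr => c _; rewrite ltn_ord.
    rewrite big1 => [|c _]; last by rewrite ltn_ord mul0r.
    by rewrite (gtn_eqF (leq_trans jm mi)).
  have jE : j = m by apply/eqP; rewrite eqn_leq mj andbT.
  rewrite {mj jm}jE /b eqxx.
  have zXm : z - X m != 0 by rewrite subr_eq0 zX.
  have [{}im|mi] := ltnP i m.
    rewrite divfK // (ltn_eqF im) -big_split /= big1 // => c _.
    by rewrite ltn_ord (ltn_eqF (ltn_ord c)) mulrN addrC subrr.
  rewrite mulVf // big1 ?add0r => [|c _]; last by rewrite ltn_ord mul0r.
  by rewrite (_ : i == m)// eqn_leq mi andbT.
set B := _ - _; set A := \matrix_(_, _) _.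
have AB : A *m B = 1%:M.
  apply/matrixP => i j; rewrite !mxE -[(i == j)%:R](main i j (ltn_ord i) (ltn_ord j)).
  apply: eq_bigr => c _; rewrite !mxE /b -val_eqE /=; congr (_ * _).
  have [cj|cj] := eqVneq; first by rewrite cj mulr1n.
  by rewrite mulr0n sub0r; case: ifP => _ //; rewrite oppr0.
have [_ Bu] := mulmx1_unit AB.
by rewrite -[LHS]mul1mx -AB -mulmxA mulmxV // mulmx1.
Qed.

End Resolvent.

(** * Splitting off the last row and column *)

Section Step.
Variable C : comNzRingType.

Lemma sum_ffun_inj (T J J' : finType) (h : T -> J' -> J) (h' : T -> J -> J')
    (P : {ffun T -> J} -> C) :
  (forall i, cancel (h i) (h' i)) ->
  (forall (k : {ffun T -> J}) i, h i (h' i (k i)) != k i -> P k = 0) ->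
  \sum_k P k = \sum_(k : {ffun T -> J'}) P [ffun i => h i (k i)].
Proof.
move=> hK P0.
rewrite (bigID (fun k : {ffun T -> J} => [forall i, h i (h' i (k i)) == k i])).
rewrite /= [X in _ + X]big1 => [|k /forallPn[i /P0//]]; rewrite addr0.
rewrite (reindex (fun k : {ffun T -> J'} => [ffun i => h i (k i)])) /=; last first.
  exists (fun k : {ffun T -> J} => [ffun i => h' i (k i)]).
    by move=> k _; apply/ffunP => i; rewrite !ffunE hK.
  by move=> k /forallP hk; apply/ffunP => i; rewrite !ffunE; exact/eqP.
apply: eq_bigl => k; apply/forallP => i; by rewrite !ffunE hK.
Qed.

Variables (m R : nat) (f : 'I_R -> 'I_R).

(* The index [None] carries the terms [delta_(R_k, 1)] of the cycle factors:
   it can only be chosen at a fixed point of [f], and adds [1] to the trace. *)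
Definition tr_entry n (a b : nat -> nat -> C) (e : bool) (k l : option 'I_n) : C :=
  match k, l with
  | Some k, Some l => \sum_(c < n) a k c * b l c
  | None, None => e%:R
  | _, _ => 0
  end.

(** The second family is stored transposed: [Y + T^t*] is lower triangular, so its resolvent is the
    transpose of one described by [res_entry]. *)
Definition tr_sum n (a b : 'I_R -> nat -> nat -> C) : C :=
  \sum_(k : {ffun 'I_R -> option 'I_n})
    \prod_i tr_entry (a i) (b i) (f i == i) (k i) (k (f i)).

(** One bordering step of [res_entry], with the smaller inverse [a], the corner [al] and the new
    column [v] kept abstract. *)
Definition row_ext (a : nat -> nat -> C) (al : C) (v : nat -> C) (i j : nat) : C :=
  if (j < m)%N then (if (i < m)%N then a i j else 0)
  else if (i < m)%N then (\sum_(c < m) a i c * v c) * al else al.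

Definition row_val (a : nat -> nat -> C) (v : nat -> C) (s : C) (k : option 'I_m) : C :=
  if k is Some k then \sum_(c < m) a k c * v c else s.

(** Once the set of rank-one indices is fixed, [None] stands for the new last index at its elements
    ([s = true]) and for the delta term elsewhere. The other reading gives a zero term, so
    [option 'I_m] suffices at every index. *)
Definition embed (s : bool) (k : option 'I_m) : option 'I_m.+1 :=
  if k is Some k then Some (lift ord_max k) else if s then Some ord_max else None.

Definition unembed (k : option 'I_m.+1) : option 'I_m := obind (unlift ord_max) k.

Lemma embedK s : cancel (embed s) unembed.
Proof. by case=> [k|] /=; rewrite ?liftK//; case: s; rewrite //= unlift_none. Qed.

Let lift_maxE (k : 'I_m) : lift ord_max k = k :> nat.
Proof. by rewrite /= /bump leqNgt ltn_ord. Qed.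

(** The product of two bordered matrices is the old product, zero on the new index, plus a rank-one
    matrix, zero on [None]. Expanding the product over [i] gives the set [S] where the rank-one part
    is taken. The value [(f i \in S)%:R] records how [None] is to be read at [f i]. *)
Lemma tr_sum_ext (a b : 'I_R -> nat -> nat -> C) (al be : 'I_R -> C) (v vb : nat -> C) :
  tr_sum m.+1 (fun i => row_ext (a i) (al i) v) (fun i => row_ext (b i) (be i) vb) =
  \sum_(S : {set 'I_R}) \sum_(k : {ffun 'I_R -> option 'I_m})
    (\prod_i if i \in S then al i * be i
            else tr_entry (a i) (b i) (f i == i) (k i) (k (f i))) *
    (\prod_(i in S) row_val (a i) v 1 (k i)) *
    (\prod_(i in S) row_val (b i) vb (f i \in S)%:R (k (f i))).
Proof.
pose w (a : nat -> nat -> C) v (k : option 'I_m.+1) : C :=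
  if k is Some k then if unlift ord_max k is Some k then \sum_(c < m) a k c * v c
  else 1 else 0.
pose g (a b : nat -> nat -> C) e (k l : option 'I_m.+1) : C :=
  match k, l with
  | Some k, Some l => if unlift ord_max k is Some k then
       if unlift ord_max l is Some l then \sum_(c < m) a k c * b l c else 0 else 0
  | None, None => e%:R
  | _, _ => 0
  end.
have entE i k l : tr_entry (row_ext (a i) (al i) v) (row_ext (b i) (be i) vb)
    (f i == i) k l = al i * be i * w (a i) v k * w (b i) vb l
       + g (a i) (b i) (f i == i) k l.
  case: k l => [k|] [l|] /=; rewrite ?mulr0 ?mul0r ?add0r//.
  rewrite big_ord_recr /= /row_ext ltnn.
  case: (unliftP ord_max k) => [k' ->|->].
    rewrite lift_maxE ltn_ord; case: (unliftP ord_max l) => [l' ->|->].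
      rewrite lift_maxE ltn_ord addrC; congr (_ + _).
        by rewrite mulrACA mulrC !mulrA.
      by apply: eq_bigr => c _; rewrite ltn_ord.
    rewrite /= ltnn addr0 big1 ?add0r => [|c _]; last by rewrite ltn_ord mulr0.
    by rewrite mulr1 -mulrA mulrC.
  rewrite /= ltnn addr0 big1 ?add0r => [|c _]; last by rewrite ltn_ord mul0r.
  case: (unliftP ord_max l) => [l' ->|->]; last by rewrite /= ltnn !mulr1.
  by rewrite lift_maxE ltn_ord mulr1 -mulrA; congr (_ * _); rewrite mulrC.
rewrite /tr_sum.
under eq_bigr => k _ do (under eq_bigr => i _ do rewrite entE).
under eq_bigr => k _ do rewrite bigA_distr.
rewrite exchange_big /=; apply: eq_bigr => S _.
rewrite (sum_ffun_inj (h := fun i => embed (i \in S)) (h' := fun=> unembed)).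
- apply: eq_bigr => k _.
  rewrite [\prod_(i in S) row_val _ v _ _]big_mkcond /=.
  rewrite [\prod_(i in S) row_val _ vb _ _]big_mkcond /=.
  rewrite -!big_split /=; apply: eq_bigr => i _; rewrite !ffunE.
  case: ifP => [iS|iS]; rewrite ?iS /=.
    congr (_ * _ * _).
      by case: (k i) => [k'|] /=; rewrite ?liftK ?unlift_none.
    case: (k (f i)) => [k'|] /=; first by rewrite liftK.
    by case: ifP => //= _; rewrite unlift_none.
  rewrite !mulr1; case: (k i) => [k'|] /=.
    by case: (k (f i)) => [l|] /=; rewrite ?liftK//; case: ifP; rewrite //= unlift_none.
  (* With [i] outside [S] and [f i] in [S], the left side links the delta index to the last index
     and is [0]; the right side is [0] because [f i] differs from [i]. *)
  case: (k (f i)) => [l|] //=; case: ifP => // fiS.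
  by case: eqP => // fi; rewrite fi iS in fiS.
- by move=> i; exact: embedK.
move=> k i ki; rewrite (bigD1 i) //= [X in X * _](_ : _ = 0) ?mul0r//.
case: ifP ki => iS; rewrite ?iS /=; case: (k i) => [k'|] //=.
- by case: (unliftP ord_max k') => [j ->|->] /=; rewrite ?eqxx.
- by rewrite mulr0 mul0r.
- case: (unliftP ord_max k') => [j ->|->] /=; rewrite ?eqxx// => _.
  by case: (k (f i)).
Qed.

End Step.

(** * Wick's theorem for the last column *)

Section Wick.
Variables (C : comNzRingType) (m R : nat).
Variables (a b : 'I_R -> nat -> nat -> C) (al be : 'I_R -> C) (p p' : 'S_R).

Let V : finType := ('I_m + bool * 'I_R)%type.
Let f (i : 'I_R) : 'I_R := (p'^-1)%g (p i).
Let finj : injective f. Proof. by move=> i j /perm_inj /perm_inj. Qed.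

Section Fixed.
Variables (S : {set 'I_R}) (k : {ffun 'I_R -> option 'I_m}).

(* The symbol [inl r] stands for the Gaussian variable [v r], and the symbols
   [inr q] for [1]; they force the permutation at the indices where no Gaussian
   variable is chosen. *)
Definition row_coef (i : 'I_R) (c : V) : C :=
  if i \in S then
    if k i is Some r then if c is inl c then a i r c else 0
    else (c == inr (true, i))%:R
  else (c == inr (false, i))%:R.

Definition col_coef (i : 'I_R) (c : V) : C :=
  if i \in S then
    if k (f i) is Some r then if c is inl c then b (p i) r c else 0
    else (f i \in S)%:R * (c == inr (true, f i))%:R
  else (c == inr (false, i))%:R.

(** Expansion of a product of affine forms in [v]: the symbols [inr q] have value [1], and the
    exponent of [v x] counts the choices of [inl x]. *)
Lemma prod_sum_inl (v : nat -> C) (h : 'I_R -> V -> C) :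
  \prod_i (\sum_(x : 'I_m) h i (inl x) * v x + \sum_q h i (inr q)) =
  \sum_(c : {ffun 'I_R -> V})
     (\prod_i h i (c i)) * \prod_(x < m) v x ^+ (\sum_i (c i == inl x)).
Proof.
pose vt (c : V) := if c is inl x then v x else 1.
transitivity (\prod_i \sum_c h i c * vt c).
  apply: eq_bigr => i _; rewrite big_sumType /=; congr (_ + _).
  by apply: eq_bigr => q _; rewrite mulr1.
rewrite bigA_distr_bigA /=; apply: eq_bigr => c _.
rewrite big_split /=; congr (_ * _).
rewrite [RHS](_ : _ = \prod_(x < m) \prod_i v x ^+ (c i == inl x)); last first.
  by apply: eq_bigr => x _; rewrite expr_sum.
rewrite exchange_big /=; apply: eq_bigr => i _.
case: (c i) => [x|q] /=; last by rewrite big1.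
rewrite (bigD1 x) //= eqxx expr1 big1 ?mulr1 // => y yx.
by rewrite (inj_eq inl_inj) eq_sym (negbTE yx).
Qed.

Lemma row_val_expand (v : nat -> C) :
  \prod_(i in S) row_val (a i) v 1 (k i) =
  \sum_(c : {ffun 'I_R -> V})
     (\prod_i row_coef i (c i)) * \prod_(x < m) v x ^+ (\sum_i (c i == inl x)).
Proof.
rewrite -prod_sum_inl big_mkcond /=; apply: eq_bigr => i _.
rewrite /row_coef; case: ifP => iS; last first.
  rewrite big1 ?add0r => [|x _]; last by rewrite mul0r.
  rewrite (bigD1 (false, i)) //= eqxx big1 ?addr0 // => q qi.
  by rewrite (inj_eq inr_inj) (negbTE qi).
rewrite /row_val; case: (k i) => [r|]; first by rewrite [X in _ + X]big1 ?addr0.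
rewrite big1 ?add0r => [|x _]; last by rewrite mul0r.
rewrite (bigD1 (true, i)) //= eqxx big1 ?addr0 // => q qi.
by rewrite (inj_eq inr_inj) (negbTE qi).
Qed.

Lemma col_val_expand (v : nat -> C) :
  \prod_(i in S) row_val (b (p i)) v (f i \in S)%:R (k (f i)) =
  \sum_(c : {ffun 'I_R -> V})
     (\prod_i col_coef i (c i)) * \prod_(x < m) v x ^+ (\sum_i (c i == inl x)).
Proof.
rewrite -prod_sum_inl big_mkcond /=; apply: eq_bigr => i _.
rewrite /col_coef; case: ifP => iS; last first.
  rewrite big1 ?add0r => [|x _]; last by rewrite mul0r.
  rewrite (bigD1 (false, i)) //= eqxx big1 ?addr0 // => q qi.
  by rewrite (inj_eq inr_inj) (negbTE qi).
rewrite /row_val; case: (k (f i)) => [r|].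
  by rewrite [X in _ + X]big1 ?addr0.
rewrite big1 ?add0r => [|x _]; last by rewrite mulr0 mul0r.
rewrite (bigD1 (true, f i)) //= eqxx mulr1 big1 ?addr0 // => q qi.
by rewrite (inj_eq inr_inj) (negbTE qi) mulr0.
Qed.

Definition base_coef : C :=
  \prod_i if i \in S then al i * be (p i)
          else tr_entry (a i) (b (p i)) (f i == i) (k i) (k (f i)).

(* The extra symbols [inr q] are matched in exactly one way, so they contribute
   only trivial moments, unless the coefficient vanishes. *)
Lemma moment_permanent (c d : {ffun 'I_R -> V}) :
  base_coef * (\prod_i row_coef i (c i)) * (\prod_i col_coef i (d i)) *
    \prod_(x < m) cgauss_moment C (\sum_i (c i == inl x)) (\sum_i (d i == inl x)) =
  base_coef * (\prod_i row_coef i (c i)) * (\prod_i col_coef i (d i)) *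
    \sum_(s : 'S_R) \prod_i (c i == d (s i))%:R.
Proof.
rewrite permanent_delta big_sumType /=.
have [base0|/eqP base0] := eqVneq base_coef 0; first by rewrite base0 !mul0r.
have [rc0|rc0] := boolP [exists i, row_coef i (c i) == 0].
  have /existsP[i /eqP i0] := rc0.
  by rewrite [\prod_i row_coef _ _](bigD1 i)//= i0 mul0r mulr0 !mul0r.
have [cc0|cc0] := boolP [exists i, col_coef i (d i) == 0].
  have /existsP[i /eqP i0] := cc0.
  by rewrite [\prod_i col_coef _ _](bigD1 i)//= i0 mul0r mulr0 !mul0r.
move/existsPn: rc0 => rc0; move/existsPn: cc0 => cc0.
(* When the coefficients are nonzero, [k (f i) = None] makes [i] and [f i] belong or not belong to
   [S] together: otherwise [col_coef] vanishes in one case, [base_coef] in the other. *)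
have bad i : i \in S -> k (f i) = None -> f i \in S.
  move=> iS kfi; have := cc0 i; rewrite /col_coef iS kfi.
  by case: (f i \in S) => //; rewrite mul0r eqxx.
have bad' i : k (f i) = None -> f i \in S -> i \in S.
  move=> kfi fiS; apply/negPn/negP => iS; apply: base0.
  rewrite /base_coef (bigD1 i) //= (negbTE iS) kfi /tr_entry.
  case: (k i) => [r|]; first by rewrite mul0r.
  case: eqP => fi; last by rewrite mul0r.
  by rewrite fi (negbTE iS) in fiS.
have ind0 (e : bool) : e%:R != 0 :> C -> e by case: e => //; rewrite eqxx.
have cE i q : (c i == inr q) =
    (q == (i \in S, i)) && ((i \in S) ==> (k i == None)).
  have := rc0 i; rewrite /row_coef; case: ifP => iS; last first.
    rewrite implyFb andbT => h; have -> : c i = inr (false, i).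
      exact/eqP/ind0.
    by rewrite (inj_eq inr_inj) eq_sym.
  case: (k i) => [r|]; rewrite ?andbF; first by case: (c i) => //= q'; rewrite eqxx.
  rewrite andbT => h; have -> : c i = inr (true, i).
    exact/eqP/ind0.
  by rewrite (inj_eq inr_inj) eq_sym.
have dE i q : (d i == inr q) = (q == (i \in S, if i \in S then f i else i)) &&
   ((i \in S) ==> (k (f i) == None)).
  have := cc0 i; rewrite /col_coef; case: ifP => iS; last first.
    rewrite implyFb andbT => h; have -> : d i = inr (false, i).
      exact/eqP/ind0.
    by rewrite (inj_eq inr_inj) eq_sym.
  case: (k (f i)) => [r|]; rewrite ?andbF.
    by case: (d i) => //= q'; rewrite eqxx.
  rewrite andbT => h; have -> : d i = inr (true, f i).
    by apply/eqP/ind0; move: h; apply: contraNneq => ->; rewrite mulr0.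
  by rewrite (inj_eq inr_inj) eq_sym.
rewrite [X in _ * (_ * X)]big1 ?mulr1 // => -[e j] _.
(* Each symbol [inr q] occurs equally often in [c] and in [d], and at most once, so its moment is
   [0!] or [1!]. *)
have cntc : (\sum_i (c i == inr (e, j)) = (e == (j \in S)) && (e ==> (k j == None)))%N.
  rewrite (bigD1 j) //= cE xpair_eqE eqxx andbT big1 ?addn0 => [|i ij].
    by case: (j \in S); case: e.
  by rewrite cE xpair_eqE [j == i]eq_sym (negbTE ij) andbF.
have cntd : (\sum_i (d i == inr (e, j)) = (e == (j \in S)) && (e ==> (k j == None)))%N.
  have [g fg gf] : bijective f by apply: injF_bij; exact: finj.
  case: e {cntc} => /=.
    rewrite (bigD1 (g j)) //= dE xpair_eqE big1 ?addn0 => [|i ij].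
      have := @bad (g j); have := @bad' (g j); rewrite gf.
      case gS: (g j \in S); rewrite /= ?gf ?eqxx /=.
        case: (k j) => [r|] _ h; first by rewrite andbF.
        by rewrite (h isT erefl).
      by case: (k j) => [r|]; case: (j \in S) => // /(_ erefl isT).
    rewrite dE xpair_eqE; case: (i \in S) => //=.
    by case: eqP => // ji; move: ij; rewrite ji fg eqxx.
  rewrite (bigD1 j) //= dE xpair_eqE big1 ?addn0 => [|i ij].
    by case: (j \in S); rewrite //= eqxx.
  rewrite dE xpair_eqE; case: (i \in S) => //=.
  by rewrite [j == i]eq_sym (negbTE ij).
by rewrite cntc cntd /cgauss_moment eqxx; case: (_ && _).
Qed.

(** For fixed [s] the deltas force [d] to be [c] composed with the inverse of [s]; the sum over [c]
    then factors over the indices. *)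
Lemma sum_permanent :
  \sum_(c : {ffun 'I_R -> V}) \sum_(d : {ffun 'I_R -> V})
     (\prod_i row_coef i (c i)) * (\prod_i col_coef i (d i)) *
      (\sum_(s : 'S_R) \prod_i (c i == d (s i))%:R) =
  \sum_(s : 'S_R) \prod_i \sum_x row_coef i x * col_coef (s i) x.
Proof.
transitivity (\sum_(c : {ffun 'I_R -> V}) \sum_(s : 'S_R) \sum_(d : {ffun 'I_R -> V})
   (\prod_i row_coef i (c i)) * (\prod_i col_coef i (d i)) *
     \prod_i ((c i == d (s i))%:R : C)).
  apply: eq_bigr => c _; rewrite exchange_big /=; apply: eq_bigr => d _.
  by rewrite mulr_sumr.
rewrite exchange_big /=; apply: eq_bigr => s _.
rewrite bigA_distr_bigA /=; apply: eq_bigr => c _.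
rewrite (bigD1 [ffun i => c ((s^-1)%g i)]) //= [X in _ + X]big1 ?addr0.
  rewrite [X in _ * X]big1 ?mulr1 => [|i _]; last by rewrite ffunE permK eqxx.
  rewrite big_split /=; congr (_ * _).
  rewrite (reindex_inj (@perm_inj _ s)) /=; apply: eq_bigr => i _.
  by rewrite ffunE permK.
move=> d dc; rewrite (_ : \prod_i (c i == d (s i))%:R = 0) ?mulr0 //.
have /forallPn[i ic] : ~~ [forall i, c i == d (s i)].
  apply: contra dc => /forallP h; apply/eqP/ffunP => i; rewrite ffunE.
  by rewrite (eqP (h _)) permKV.
by rewrite (bigD1 i) //= (negbTE ic) mul0r.
Qed.

(** Inside [S], contracting the Gaussian symbols restores an entry of the product of the smaller
    matrices, and the symbols [inr (true, _)] restore the delta term. Outside [S], the symbols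
    [inr (false, _)] force [j = i]. *)
Lemma pair_coef i j :
  \sum_x row_coef i x * col_coef j x =
  if i \in S then
    if j \in S then tr_entry (a i) (b (p j)) (f j == i) (k i) (k (f j)) else 0
  else (j == i)%:R.
Proof.
rewrite big_sumType /= /row_coef /col_coef.
have sum_inr q0 (F : bool * 'I_R -> C) :
    \sum_q ((inr q : V) == inr q0)%:R * F q = F q0.
  rewrite (bigD1 q0) //= eqxx mul1r big1 ?addr0 // => q qq.
  by rewrite (inj_eq inr_inj) (negbTE qq) mul0r.
have inl_inr x q : ((inl x : V) == inr q) = false by [].
case: (boolP (i \in S)) => iS; case: (boolP (j \in S)) => jS.
- case: (k i) => [r|]; rewrite /tr_entry.
    rewrite [X in _ + X]big1 ?addr0 => [|q _]; last by rewrite mul0r.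
    case: (k (f j)) => [l|] //.
    by rewrite big1 // => x _; rewrite inl_inr !mulr0.
  rewrite sum_inr big1 ?add0r => [|x _]; last by rewrite inl_inr mul0r.
  case: (k (f j)) => [l|] //.
  rewrite (inj_eq inr_inj) xpair_eqE /= eq_sym.
  by case: eqP => [->|]; rewrite ?mulr0 // iS mulr1.
- rewrite big1 ?add0r => [|x _]; last by rewrite inl_inr mulr0.
  rewrite big1 // => q _; case: (k i) => [r|]; rewrite ?mul0r //.
  rewrite -natrM mulnb; case: eqP => //= ->.
  by rewrite (inj_eq inr_inj).
- rewrite sum_inr big1 ?add0r => [|x _]; last by rewrite inl_inr mul0r.
  case: (k (f j)) => [l|]; rewrite ?(inj_eq inr_inj) ?mulr0 //=.
    by case: eqP => // ji; rewrite ji (negbTE iS) in jS.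
  by case: eqP => // ji; rewrite ji (negbTE iS) in jS.
rewrite sum_inr big1 ?add0r => [|x _]; last by rewrite inl_inr mul0r.
by rewrite (inj_eq inr_inj) xpair_eqE eqxx /= eq_sym.
Qed.

End Fixed.

Lemma wick_step :
  \sum_(S : {set 'I_R}) \sum_(k : {ffun 'I_R -> option 'I_m})
   \sum_(c : {ffun 'I_R -> V}) \sum_(d : {ffun 'I_R -> V})
    base_coef S k * (\prod_i row_coef S k i (c i)) * (\prod_i col_coef S k i (d i)) *
    \prod_(x < m) cgauss_moment C (\sum_i (c i == inl x)) (\sum_i (d i == inl x)) =
  \sum_(r : 'S_R) (\prod_i ((p i == r i)%:R + al i * be (p i))) *
    tr_sum (fun i => (p'^-1)%g (r i)) m a (fun i => b (r i)).
Proof.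
under [RHS]eq_bigr => r _ do (under eq_bigr => i _ do rewrite addrC).
under [RHS]eq_bigr => r _ do rewrite bigA_distr big_distrl /=.
rewrite [RHS]exchange_big /=; apply: eq_bigr => S _.
under [RHS]eq_bigr => r _ do rewrite /tr_sum big_distrr /=.
rewrite [RHS]exchange_big /=; apply: eq_bigr => k _.
transitivity (base_coef S k *
  \sum_(s : 'S_R) \prod_i \sum_x row_coef S k i x * col_coef S k (s i) x).
  rewrite -sum_permanent big_distrr /=; apply: eq_bigr => c _.
  rewrite big_distrr /=; apply: eq_bigr => d _.
  by rewrite moment_permanent !mulrA.
(* A pairing [s] corresponds to [r = s * p], that is [r i = p (s i)], whose cycle map is [f] after
   [s]. *)
rewrite [RHS](reindex_inj (mulIg p)) /= big_distrr /=; apply: eq_bigr => s _.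
under eq_bigr => i _ do rewrite pair_coef.
(* Both sides vanish unless [s] fixes the complement of [S], and then [s] preserves [S]. *)
have [sS|/forallPn[i0]] := boolP [forall (i | i \notin S), s i == i].
  have sE i : (s i \in S) = (i \in S).
    apply/idP/idP => [|iS].
      apply: contraLR => iS.
      by move/forallP/(_ i)/implyP/(_ iS)/eqP: sS => ->.
    apply/negPn/negP => siS.
    have /eqP/perm_inj si : s (s i) == s i.
      by move/forallP/(_ (s i))/implyP: sS; exact.
    by rewrite si iS in siS.
  rewrite /base_coef -!big_split /=; apply: eq_bigr => i _.
  rewrite permM sE; case: ifP => iS; first by [].
  move/forallP/(_ i): sS; rewrite iS /= => /eqP ->.
  by rewrite !eqxx mulr1 mul1r.
rewrite negb_imply => /andP[iS si].
rewrite [X in _ * X](bigD1 i0) //= (negbTE iS) (negbTE si) mul0r mulr0.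
rewrite [X in _ = X * _](bigD1 i0) //= (negbTE iS) permM (inj_eq perm_inj).
by rewrite eq_sym (negbTE si) !mul0r.
Qed.

End Wick.

(** * Gaussian expectations of polynomials in a triangular matrix *)

Section TraceForm.
Variables (C : comNzRingType) (n R : nat) (f : 'I_R -> 'I_R).
Variables (P Q : 'I_R -> 'M[C]_n) (a b : 'I_R -> nat -> nat -> C).
Hypotheses (finj : injective f).
Hypotheses (PE : forall i, P i = \matrix_(k, l) a i k l).
Hypotheses (QE : forall i, Q i = \matrix_(k, l) b i l k).

(** The index [None] is never linked to the others, so the matrices are block diagonal. Each cycle
    trace splits into the trace of the matrix product and the product of the scalars at [None],
    which is [1] exactly on a cycle of length one. *)
Lemma tr_sum_cycles :
  tr_sum f n a b =
  \prod_(c in froots f) ((fingraph.order f c == 1)%:R +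
     \tr (\prod_(l < fingraph.order f c) (P (iter l f c) * Q (iter l f c)))).
Proof.
pose M i := tr_entry (a i) (b i) (f i == i) : option 'I_n -> option 'I_n -> C.
rewrite /tr_sum (@sum_ffun_cycles _ _ _ f None finj M).
apply: eq_bigr => c _.
have PQ i (k l : 'I_n) : M i (Some k) (Some l) = (P i * Q i) k l.
  by rewrite -mulmxE mxE PE QE; apply: eq_bigr => d _; rewrite !mxE.
have sum_opt (F : option 'I_n -> C) : \sum_o F o = F None + \sum_k F (Some k).
  rewrite (bigD1 None) //=; congr (_ + _).
  by rewrite (reindex_omap Some id) //=; [apply: eq_bigl => k; rewrite eqxx | case].
have MNN i : M i None None = (f i == i)%:R by [].
have MSN i k : M i (Some k) None = 0 by [].
have MNS i k : M i None (Some k) = 0 by [].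
clearbody M.
have chE q : let ch := chain (fun l => M (iter l f c)) q in
    [/\ forall k l, ch (Some k) (Some l) =
          (\prod_(l < q) (P (iter l f c) * Q (iter l f c))) k l,
        ch None None = \prod_(l < q) (iter l.+1 f c == iter l f c)%:R,
        forall k, ch (Some k) None = 0 & forall k, ch None (Some k) = 0].
  elim: q => [|q [IH1 IH2 IH3 IH4]] /=.
    split=> // [k l|]; last by rewrite big_ord0.
    by rewrite big_ord0 mxE; congr (_ *+ _).
  split=> [k l||k|k]; rewrite sum_opt.
  - rewrite IH3 mul0r add0r big_ord_recr /= -mulmxE mxE.
    by apply: eq_bigr => d _; rewrite IH1 PQ.
  - rewrite big_ord_recr /= IH2 MNN [X in _ + X]big1 ?addr0 // => d _.
    by rewrite IH4 mul0r.
  - by rewrite IH3 mul0r add0r big1 // => d _; rewrite MSN mulr0.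
  - by rewrite MNS mulr0 add0r big1 // => d _; rewrite IH4 mul0r.
have /= [ch1 ch2 _ _] := chE (fingraph.order f c).
rewrite sum_opt ch2 {ch2}; congr (_ + _); last first.
  by rewrite /mxtrace; apply: eq_bigr => k _; rewrite ch1.
have [fc|fc] := eqVneq (f c) c.
  have -> : fingraph.order f c = 1.
    by apply: (@order_cycle _ f [:: c]); rewrite ?inE //= fc eqxx.
  by rewrite big_ord1 /= fc eqxx.
have := fingraph.order_gt0 f c; have := iter_order finj c.
case: (fingraph.order f c) => // q cq _; rewrite big_ord_recl /= (negbTE fc) mul0r.
by case: q cq => // cq; move: fc; rewrite -[X in _ != X]cq eqxx.
Qed.

End TraceForm.

Section Gaussian.
Variable C : numClosedFieldType.

Section Polynomials.
Variable n : nat.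

Definition tri_monomial (al be : nat -> nat -> nat) (t : nat -> nat -> C) : C :=
  \prod_(j < n) \prod_(i < n | (i < j)%N) (t i j ^+ al i j * (t i j)^* ^+ be i j).

Definition tri_moment (al be : nat -> nat -> nat) : C :=
  \prod_(j < n) \prod_(i < n | (i < j)%N) cgauss_moment C (al i j) (be i j).

(** The graph of the expectation, generated by monomials and linear combinations. Polynomials are
    represented by functions, so uniqueness of the value is not evident; it comes from the integral,
    in [gauss_expect_uniq]. *)
Inductive gauss_expect : ((nat -> nat -> C) -> C) -> C -> Prop :=
| gauss_expect_monomial al be :
    gauss_expect (tri_monomial al be) (tri_moment al be)
| gauss_expect0 : gauss_expect (fun=> 0) 0
| gauss_expect_lin z phi c psi d : gauss_expect phi c -> gauss_expect psi d ->
    gauss_expect (fun t => z * phi t + psi t) (z * c + d)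
| gauss_expect_ext phi psi c : phi =1 psi -> gauss_expect phi c ->
    gauss_expect psi c.

Definition tri_poly phi := exists c, gauss_expect phi c.

Lemma tri_poly_ext phi psi : phi =1 psi -> tri_poly phi -> tri_poly psi.
Proof. by move=> e [c h]; exists c; apply: gauss_expect_ext e h. Qed.

Lemma gauss_expect_sum (I : Type) (r : seq I) (phi : I -> (nat -> nat -> C) -> C)
    (c z : I -> C) : (forall i, gauss_expect (phi i) (c i)) ->
  gauss_expect (fun t => \sum_(i <- r) z i * phi i t) (\sum_(i <- r) z i * c i).
Proof.
move=> h; elim: r => [|i r IHr].
  rewrite big_nil; apply: gauss_expect_ext gauss_expect0 => t.
  by rewrite big_nil.
rewrite big_cons; apply: gauss_expect_ext (gauss_expect_lin (z i) (h i) IHr) => t.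
by rewrite big_cons.
Qed.

Lemma tri_poly_lin z phi psi : tri_poly phi -> tri_poly psi ->
  tri_poly (fun t => z * phi t + psi t).
Proof. by move=> [c hc] [d hd]; exists (z * c + d); exact: gauss_expect_lin. Qed.

Lemma tri_poly0 : tri_poly (fun=> 0).
Proof. by exists 0; exact: gauss_expect0. Qed.

(** Double induction on the two derivations, adding exponents for monomials. Only existence of a
    value is claimed, as the expectation is not multiplicative. *)
Lemma tri_polyM phi psi : tri_poly phi -> tri_poly psi ->
  tri_poly (fun t => phi t * psi t).
Proof.
move=> [c + [d]]; elim=> {phi c} [al be||z phi1 c1 phi2 c2 _ IH1 _ IH2|phi1 phi2 c e _ IH].
- elim=> {psi d} [al' be'||z psi1 c1 psi2 c2 _ IH1 _ IH2|psi1 psi2 c e _ IH].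
  + eexists; apply: gauss_expect_ext (gauss_expect_monomial
      (fun i j => al i j + al' i j)%N (fun i j => be i j + be' i j)%N) => t.
    rewrite -big_split /=; apply: eq_bigr => j _.
    rewrite -big_split /=; apply: eq_bigr => i _.
    by rewrite !exprD mulrACA.
  + by apply: tri_poly_ext tri_poly0 => t; rewrite mulr0.
  + by apply: tri_poly_ext (tri_poly_lin z IH1 IH2) => t; rewrite mulrDr mulrCA.
  + by apply: tri_poly_ext IH => t; rewrite e.
- by move=> _; apply: tri_poly_ext tri_poly0 => t; rewrite mul0r.
- move=> hpsi; apply: tri_poly_ext (tri_poly_lin z (IH1 hpsi) (IH2 hpsi)) => t.
  by rewrite mulrDl mulrA.
by move=> hpsi; apply: tri_poly_ext (IH hpsi) => t; rewrite e.
Qed.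

Lemma tri_poly_cst z : tri_poly (fun=> z).
Proof.
apply: tri_poly_ext (tri_poly_lin z (ex_intro _ _ (gauss_expect_monomial
  (fun _ _ => 0%N) (fun _ _ => 0%N))) tri_poly0) => t.
rewrite addr0 /tri_monomial big1 ?mulr1 // => j _.
by rewrite big1 // => i _; rewrite !expr0 mulr1.
Qed.

Lemma tri_polyD phi psi : tri_poly phi -> tri_poly psi ->
  tri_poly (fun t => phi t + psi t).
Proof.
move=> h1 h2; apply: tri_poly_ext (tri_poly_lin 1 h1 h2) => t.
by rewrite mul1r.
Qed.

Lemma tri_poly_sum (I : Type) (r : seq I) (A : pred I)
    (phi : I -> (nat -> nat -> C) -> C) :
  (forall i, A i -> tri_poly (phi i)) -> tri_poly (fun t => \sum_(i <- r | A i) phi i t).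
Proof.
move=> h; elim: r => [|i r IHr].
  by apply: tri_poly_ext tri_poly0 => t; rewrite big_nil.
case Ai : (A i); last by apply: tri_poly_ext IHr => t; rewrite big_cons Ai.
by apply: tri_poly_ext (tri_polyD (h i Ai) IHr) => t; rewrite big_cons Ai.
Qed.

Lemma tri_poly_prod (I : Type) (r : seq I) (A : pred I)
    (phi : I -> (nat -> nat -> C) -> C) :
  (forall i, A i -> tri_poly (phi i)) -> tri_poly (fun t => \prod_(i <- r | A i) phi i t).
Proof.
move=> h; elim: r => [|i r IHr].
  by apply: tri_poly_ext (tri_poly_cst 1) => t; rewrite big_nil.
case Ai : (A i); last by apply: tri_poly_ext IHr => t; rewrite big_cons Ai.
by apply: tri_poly_ext (tri_polyM (h i Ai) IHr) => t; rewrite big_cons Ai.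
Qed.

Lemma tri_poly_var (e : bool) i j : (i < j < n)%N ->
  tri_poly (fun t => if e then (t i j)^* else t i j).
Proof.
move=> /andP[ij jn]; have in' := ltn_trans ij jn.
pose al (s : bool) i' j' := (s && (i' == i) && (j' == j) : nat).
eexists; apply: gauss_expect_ext (gauss_expect_monomial (al (~~ e)) (al e)) => t.
rewrite /tri_monomial (bigD1 (Ordinal jn)) //= [X in _ * X]big1 => [|j' j'j].
  rewrite mulr1 (bigD1 (Ordinal in')) //= [X in _ * X]big1 => [|i' /andP[_ i'i]].
    by rewrite /al !eqxx; case: e; rewrite /= ?expr1 ?expr0 ?mulr1 ?mul1r.
  rewrite -val_eqE /= in i'i.
  by rewrite /al (negbTE i'i) !andbF /= !expr0 mulr1.
rewrite -val_eqE /= in j'j.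
by rewrite big1 // => i' _; rewrite /al (negbTE j'j) !andbF !expr0 mulr1.
Qed.

End Polynomials.

Lemma tri_poly_res n z X (e : bool) i j :
  tri_poly n (fun t => res_entry z X (fun i j => if e then (t i j)^* else t i j) n i j).
Proof.
(* The number [n] of columns stays fixed while the induction runs over the smaller resolvents. *)
suff h m : (m <= n)%N -> forall i j, tri_poly n (fun t =>
    res_entry z X (fun i j => if e then (t i j)^* else t i j) m i j) by exact: h.
elim: m => [|m IHm] mn i' j' /=; first exact: tri_poly_cst.
case: (j' < m)%N; case: (i' < m)%N; try exact: tri_poly_cst.
  by apply: IHm; exact: ltnW.
apply: tri_polyM; last exact: tri_poly_cst.
apply: tri_poly_sum => c _; apply: tri_polyM; first by apply: IHm; exact: ltnW.
by apply: tri_poly_var; rewrite ltn_ord.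
Qed.

Definition col_monomial m (al be : 'I_m -> nat) (t : nat -> nat -> C) : C :=
  \prod_(x < m) (t x m ^+ al x * (t x m)^* ^+ be x).

(* [Psi] is the average of [Phi] over the last column. *)
Definition expect_reduce m Phi Psi :=
  exists2 c, gauss_expect m.+1 Phi c & gauss_expect m Psi c.

Lemma expect_reduce_ext m Phi Phi' Psi Psi' : Phi =1 Phi' -> Psi =1 Psi' ->
  expect_reduce m Phi Psi -> expect_reduce m Phi' Psi'.
Proof.
move=> e e' [c h h'].
by exists c; [exact: gauss_expect_ext h | exact: gauss_expect_ext h'].
Qed.

Lemma expect_reduce_sum m (I : Type) (r : seq I) Phi Psi :
  (forall i : I, expect_reduce m (Phi i) (Psi i)) ->
  expect_reduce m (fun t => \sum_(i <- r) Phi i t) (fun t => \sum_(i <- r) Psi i t).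
Proof.
move=> h; elim: r => [|i r [c h1 h2]].
  by exists 0; apply: gauss_expect_ext (gauss_expect0 _) => t; rewrite big_nil.
have [d h3 h4] := h i; exists (1 * d + c).
  by apply: gauss_expect_ext (gauss_expect_lin 1 h3 h1) => t; rewrite big_cons mul1r.
by apply: gauss_expect_ext (gauss_expect_lin 1 h4 h2) => t; rewrite big_cons mul1r.
Qed.

Lemma expect_reduce_col m G (al be : 'I_m -> nat) : tri_poly m G ->
  expect_reduce m (fun t => G t * col_monomial al be t)
    (fun t => G t * \prod_(x < m) cgauss_moment C (al x) (be x)).
Proof.
set mom := \prod_(x < m) _; move=> [c hG]; exists (mom * c + 0); last first.
  apply: gauss_expect_ext (gauss_expect_lin mom hG (gauss_expect0 _)) => t.
  by rewrite addr0 mulrC.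
rewrite addr0 mulrC; elim: hG => {G c}.
- move=> al' be'.
  pose ext (h : nat -> nat -> nat) (g : 'I_m -> nat) i j :=
    if j == m then oapp g 0%N (insub i) else h i j.
  have momE : tri_moment m.+1 (ext al' al) (ext be' be) = tri_moment m al' be' * mom.
    rewrite /tri_moment big_ord_recr /=; congr (_ * _).
      apply: eq_bigr => j _; rewrite big_mkcond big_ord_recr /= ltnNge ltnW //= mulr1.
      rewrite -big_mkcond /=; apply: eq_bigr => i _.
      by rewrite /ext (ltn_eqF (ltn_ord j)).
    rewrite big_mkcond big_ord_recr /= ltnn mulr1 /mom; apply: eq_bigr => i _.
    by rewrite ltn_ord /ext eqxx valK.
  rewrite -momE; apply: gauss_expect_ext (gauss_expect_monomial _ _ _) => t.
  rewrite /tri_monomial big_ord_recr /=; congr (_ * _).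
    apply: eq_bigr => j _; rewrite big_mkcond big_ord_recr /= ltnNge ltnW //= mulr1.
    rewrite -big_mkcond /=; apply: eq_bigr => i _.
    by rewrite /ext (ltn_eqF (ltn_ord j)).
  rewrite big_mkcond big_ord_recr /= ltnn mulr1; apply: eq_bigr => i _.
  by rewrite ltn_ord /ext eqxx valK.
- rewrite mul0r; apply: gauss_expect_ext (gauss_expect0 _) => t.
  by rewrite mul0r.
- move=> z phi c psi d _ IH1 _ IH2; rewrite mulrDl -mulrA.
  apply: gauss_expect_ext (gauss_expect_lin z IH1 IH2) => t.
  by rewrite mulrDl mulrA.
- move=> phi psi c e _ IH; apply: gauss_expect_ext IH => t.
  by rewrite e.
Qed.

(** * Averaging out one column at a time *)

Section Recursion.
Variables (R : nat) (x y : 'I_R -> C) (X Y : nat -> C) (p' : 'S_R).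
Hypothesis expect_uniq :
  forall n phi c d, gauss_expect n phi c -> gauss_expect n phi d -> c = d.

Definition F_poly n (p : 'S_R) (t : nat -> nat -> C) : C :=
  tr_sum (fun i => (p'^-1)%g (p i)) n (fun i => res_entry (x i) X t n)
    (fun i => res_entry (y (p i)) Y (fun k l => (t k l)^* ) n).

Fixpoint F_value n (p : 'S_R) : C :=
  if n is m.+1 then
    \sum_(q : 'S_R)
      (\prod_i ((p i == q i)%:R + ((x i - X m) * (y (p i) - Y m))^-1)) * F_value m q
  else (p == p')%:R.

(** [tr_sum_ext] isolates the last column, [row_val_expand] and [col_val_expand] write it in
    monomials, averaging turns these into moments, and [wick_step] resums. *)
Lemma F_poly_reduce m p :
  expect_reduce m (F_poly m.+1 p)
    (fun t => \sum_(q : 'S_R)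
      (\prod_i ((p i == q i)%:R + ((x i - X m) * (y (p i) - Y m))^-1)) * F_poly m q t).
Proof.
pose tb (t : nat -> nat -> C) k l := (t k l)^*.
pose a t i := res_entry (x i) X t m; pose b t j := res_entry (y j) Y (tb t) m.
pose al i := (x i - X m)^-1; pose be j := (y j - Y m)^-1.
pose G t S (k : {ffun 'I_R -> option 'I_m})
    (c d : {ffun 'I_R -> 'I_m + bool * 'I_R}) := base_coef (a t) (b t) al be p p' S k *
  (\prod_i row_coef (a t) S k i (c i)) * (\prod_i col_coef (b t) p p' S k i (d i)).
pose cnt (c : {ffun 'I_R -> 'I_m + bool * 'I_R}) (z : 'I_m) := (\sum_i (c i == inl z))%N.
apply: (@expect_reduce_ext m (fun t =>
   \sum_(S : {set 'I_R}) \sum_(k : {ffun 'I_R -> option 'I_m})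
   \sum_(c : {ffun 'I_R -> 'I_m + bool * 'I_R})
   \sum_(d : {ffun 'I_R -> 'I_m + bool * 'I_R})
   G t S k c d * col_monomial (cnt c) (cnt d) t) _
   (fun t =>
   \sum_(S : {set 'I_R}) \sum_(k : {ffun 'I_R -> option 'I_m})
   \sum_(c : {ffun 'I_R -> 'I_m + bool * 'I_R})
   \sum_(d : {ffun 'I_R -> 'I_m + bool * 'I_R})
   G t S k c d * \prod_(z < m) cgauss_moment C (cnt c z) (cnt d z))).
- move=> t; rewrite /F_poly.
  (* One step of [res_entry] is [row_ext] by computation. *)
  transitivity (tr_sum (fun i => (p'^-1)%g (p i)) m.+1
    (fun i => row_ext m (a t i) (al i) (fun c => t c m))
    (fun i => row_ext m (b t (p i)) (be (p i)) (fun c => tb t c m))) => //.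
  rewrite tr_sum_ext.
  apply/esym; apply: eq_bigr => S _; apply: eq_bigr => k _; apply/esym.
  rewrite (row_val_expand (a t)) (col_val_expand (b t) p p').
  rewrite -mulrA big_distrlr /= big_distrr /=; apply: eq_bigr => c _.
  rewrite big_distrr /=; apply: eq_bigr => d _.
  rewrite /G -/(base_coef (a t) (b t) al be p p' S k) -!mulrA; congr (_ * _).
  congr (_ * _); rewrite mulrCA; congr (_ * _).
  by rewrite /col_monomial big_split.
- move=> t; rewrite (wick_step m (a t) (b t) al be p p').
  apply: eq_bigr => q _; congr (_ * _); apply: eq_bigr => i _.
  by rewrite /al /be invfM.
apply: expect_reduce_sum => S; apply: expect_reduce_sum => k.
apply: expect_reduce_sum => c; apply: expect_reduce_sum => d.
apply: expect_reduce_col.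
have pa i r l : tri_poly m (fun t => a t i r l).
  exact: (tri_poly_res m (x i) X false r l).
have pb i r l : tri_poly m (fun t => b t i r l).
  exact: (tri_poly_res m (y i) Y true r l).
apply: tri_polyM; first apply: tri_polyM; apply: tri_poly_prod => i _.
- case: (i \in S); first exact: tri_poly_cst.
  rewrite /tr_entry.
  case: (k i) => [r|]; case: (k ((p'^-1)%g (p i))) => [l|]; try exact: tri_poly_cst.
  by apply: tri_poly_sum => z _; exact: tri_polyM.
- rewrite /row_coef; case: (i \in S); last exact: tri_poly_cst.
  case: (k i) => [r|]; last exact: tri_poly_cst.
  by case: (c i) => [z|?]; [exact: pa | exact: tri_poly_cst].
rewrite /col_coef; case: (i \in S); last exact: tri_poly_cst.
case: (k ((p'^-1)%g (p i))) => [r|]; last exact: tri_poly_cst.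
by case: (d i) => [z|?]; [exact: pb | exact: tri_poly_cst].
Qed.

(** The value provided by [F_poly_reduce] is also an expectation of a combination of the
    [F_poly m q]; uniqueness identifies it through the induction hypothesis. *)
Lemma gauss_expect_F n p : gauss_expect n (F_poly n p) (F_value n p).
Proof.
elim: n p => [|m IHm] p /=; last first.
  have [c hc hc'] := F_poly_reduce m p.
  suff cE : c = F_value m.+1 p by rewrite cE in hc.
  exact: expect_uniq hc' (gauss_expect_sum (index_enum _) _ IHm).
have := gauss_expect_lin (p == p')%:R
    (gauss_expect_monomial 0 (fun _ _ => 0%N) (fun _ _ => 0%N)) (gauss_expect0 0).
rewrite addr0 {1}/tri_moment big_ord0 mulr1.
apply: gauss_expect_ext => t; rewrite addr0 /tri_monomial big_ord0 mulr1.
(* With no matrix index left, only the constant assignment [None] remains; it tests [p i = p' i] for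
   every [i]. *)
rewrite /F_poly /tr_sum (big_pred1 [ffun=> None]) => [|k]; last first.
  by apply/esym/eqP/ffunP => i; rewrite ffunE; case: (k i) => [[]|].
have [->|pp] := eqVneq p p'.
  by rewrite big1 // => i _; rewrite !ffunE /= permK eqxx.
have /forallPn[i pi] : ~~ [forall i, p i == p' i].
  by apply: contra pp => /forallP h; apply/eqP/permP => i; exact/eqP.
rewrite (bigD1 i) //= !ffunE /= (_ : _ == i = false) ?mul0r //.
by rewrite -(inj_eq (@perm_inj _ p')) permKV (negbTE pi).
Qed.

End Recursion.
End Gaussian.

(** * Gaussian integrals *)

Import numFieldNormedType.Exports.
Local Open Scope classical_set_scope.
Local Open Scope ring_scope.
Local Open Scope complex_scope.

Section GaussianMoments.
Variable K : realType.
Implicit Types (p : {poly K}) (x : K).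
Let mu := @lebesgue_measure K.

(** A single term of the exponential series is at most its sum. *)
Lemma exp_dominates_power k x : `|x| ^+ k <= k`!%:R * expR `|x|.
Proof.
case: k => [|k]; first by rewrite expr0 mul1r -[leLHS]expR0 ler_expR.
have := @expR_ge1Dxn K `|x| k (normr_ge0 x).
rewrite -ler_pdivrMl ?ltr0n ?fact_gt0 // mulrC; apply: le_trans.
by rewrite lerDr.
Qed.

(** Comparison with a normal density gives both integrability and boundedness. The polynomial is at
    most [c * expR |x|], and [|x| - x^2 <= 1 - x^2 / 2] because [(|x| - 1)^2 >= 0]; hence the factor
    [expR 1]. *)
Lemma poly_gauss_bound p :
  exists D, forall x, `|p.[x] * gauss_fun x| <= D * normal_pdf 0 1 x.
Proof.
pose c := \sum_(k < size p) `|p`_k| * (k`!%:R).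
exists (c * expR 1 / normal_peak 1) => x.
rewrite normal_pdfE ?oner_eq0 //= mulrA divfK ?gt_eqF ?normal_peak_gt0 ?oner_eq0 //.
rewrite normrM [X in _ * X]ger0_norm ?expR_ge0 //.
have px : `|p.[x]| <= c * expR `|x|.
  rewrite horner_coef mulr_suml (le_trans (ler_norm_sum _ _ _)) //.
  apply: ler_sum => k _; rewrite normrM normrX -mulrA ler_wpM2l //.
  exact: exp_dominates_power.
have c0 : 0 <= c by apply: sumr_ge0 => k _; rewrite mulr_ge0.
rewrite (le_trans (ler_wpM2r (expR_ge0 _) px)) // -!mulrA ler_wpM2l //.
rewrite /gauss_fun /normal_fun -!expRD ler_expR subr0 expr1n.
have xx : x ^+ 2 = `|x| ^+ 2 by rewrite real_normK ?num_real.
rewrite xx; set y := `|x|.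
have : 0 <= (y - 1) ^+ 2 by exact: sqr_ge0.
by lra.
Qed.

Lemma continuous_poly_gauss p : continuous (fun x => p.[x] * gauss_fun x).
Proof.
move=> x; apply: cvgM; first exact: continuous_horner.
exact: continuous_gauss_fun.
Qed.

Lemma measurable_poly_gauss p : measurable_fun setT (fun x => p.[x] * gauss_fun x).
Proof. apply: continuous_measurable_fun; exact: continuous_poly_gauss. Qed.

Lemma integrable_poly_gauss p :
  mu.-integrable setT (EFin \o (fun x => p.[x] * gauss_fun x)).
Proof.
have [D hD] := poly_gauss_bound p.
apply: (@le_integrable _ _ _ mu setT _ _ (EFin \o (fun x => D * normal_pdf 0 1 x))) => //.
- by apply/measurable_EFinP; exact: measurable_poly_gauss.
- by move=> x _ /=; rewrite lee_fin (le_trans (hD x)) // ler_norm.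
exact: (integrableZl measurableT D (@integrable_normal_pdf K 0 1)).
Qed.

(** Bounding the function for ['X * p] gives decay like [1 / (n + 1)]; [s] is the sign of the end of
    the line. *)
Lemma cvg_poly_gauss p (s : K) : `|s| = 1 ->
  (p.[s * n.+1%:R] * gauss_fun (s * n.+1%:R)) @[n --> \oo] --> (0 : K).
Proof.
move=> s1; have [D hD] := poly_gauss_bound ('X * p).
pose E := D * normal_peak 1.
have hE x : `|('X * p).[x] * gauss_fun x| <= `|E|.
  rewrite (le_trans (hD x)) // (le_trans (ler_norm _)) // !normrM ler_wpM2l //.
  by rewrite !ger0_norm ?normal_pdf_ge0 ?normal_peak_ge0 // normal_pdf_ub ?oner_eq0.
apply/norm_cvg0P.
apply: (@squeeze_cvgr _ _ _ _ (fun=> 0) (fun n => `|E| * harmonic n)).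
- near=> n; rewrite normr_ge0 /= ler_pdivlMr ?ltr0n //.
  have := hE (s * n.+1%:R); rewrite hornerM hornerX -mulrA normrM normrM s1 mul1r.
  by rewrite [X in X * _]ger0_norm // mulrC.
- exact: cvg_cst.
- rewrite -[X in _ --> X](mulr0 `|E|); apply: cvgM; first exact: cvg_cst.
  exact: cvg_harmonic.
Unshelve. all: by end_near. Qed.

(** The integrand is the derivative of [p.[x] * gauss_fun x]. Over [[-(n + 1), n + 1]] its integral
    is a difference of boundary values tending to [0], and dominated convergence passes to the whole
    line. *)
Lemma poly_gauss_by_parts p :
  \int[mu]_x ((p^`() - 2%:P * 'X * p).[x] * gauss_fun x) = 0.
Proof.
set f := fun x => _; set q := p^`() - _ in f *.
pose F x : K := p.[x] * gauss_fun x.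
have dF x : is_derive x 1 F (f x).
  rewrite /F /gauss_fun; apply: trigger_derive.
  rewrite /f /q !hornerE /GRing.scale /= /gauss_fun.
  by ring.
pose B n : set K := `[- n.+1%:R, n.+1%:R]%classic.
have intB n : (\int[mu]_(x in B n) (f x)%:E = (F n.+1%:R - F (- n.+1%:R))%:E)%E.
  rewrite /B (@continuous_FTC2 _ _ F) //.
  - by rewrite (lt_trans (y := 0)) ?oppr_lt0 ?ltr0n.
  - by apply: continuous_subspaceT; exact: continuous_poly_gauss.
  - split=> [x _||].
    + exact: ex_derive.
    + by apply: cvg_at_right_filter; exact: continuous_poly_gauss.
    + by apply: cvg_at_left_filter; exact: continuous_poly_gauss.
  - by move=> x _; rewrite derive1E; exact: derive_val.
have intf : mu.-integrable setT (EFin \o f) by exact: integrable_poly_gauss.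
have mf : measurable_fun setT f by exact: measurable_poly_gauss.
have mB n : measurable (B n) by exact: measurable_itv.
have [_ _ cvgf] : [/\ mu.-integrable setT (EFin \o f),
    [sequence (\int[mu]_x `|((f \_ (B n)) x)%:E - (f x)%:E|)%E]_n @ \oo --> 0%E &
    [sequence (\int[mu]_x ((f \_ (B n)) x)%:E)%E]_n @ \oo --> (\int[mu]_x (f x)%:E)%E].
  apply: (@dominated_convergence _ _ _ mu setT measurableT _ _ (fun x => `|f x|%:E)).
  - move=> n; apply/measurable_EFinP/(measurable_restrictT f (mB n)).
    exact: measurable_funTS.
  - exact/measurable_EFinP.
  - apply: aeW => x _; apply: cvg_near_cst.
    have := @nbhs_infty_ger K `|x|; apply: filterS => n nx.
    rewrite /= patchE ifT // inE /B /= in_itv /= -ler_norml (le_trans nx) //.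
    by rewrite ler_nat.
  - exact: (integrable_norm intf).
  - apply: aeW => x n _; rewrite /= lee_fin patchE; case: ifP => // _.
    by rewrite normr0.
have cvg0 : [sequence (\int[mu]_x ((f \_ (B n)) x)%:E)%E]_n @ \oo --> 0%E.
  rewrite (_ : [sequence _]_n = (fun n => (F n.+1%:R - F (- n.+1%:R))%:E)); last first.
    apply/funext => n; rewrite -intB [RHS]integral_mkcond /=.
    by apply: eq_integral => x _; rewrite restrict_EFin.
  apply: cvg_EFin; first exact: nearW.
  rewrite -[X in _ --> X](subr0 0); apply: cvgB.
    under eq_fun do rewrite -[X in F X]mul1r.
    by apply: cvg_poly_gauss; rewrite normr1.
  under eq_fun do rewrite -mulN1r.
  by apply: cvg_poly_gauss; rewrite normrN1.
have := cvg_unique _ cvgf cvg0.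
by rewrite /Rintegral => ->.
Qed.
End GaussianMoments.

(** * Integrals of products of functions of separate variables *)

Section ProductIntegral.
Context d1 d2 (T1 : measurableType d1) (T2 : measurableType d2) (K : realType).
Variables (m1 : {sigma_finite_measure set T1 -> \bar K}).
Variables (m2 : {sigma_finite_measure set T2 -> \bar K}).
Variables (a : T1 -> K) (b : T2 -> K).
Hypotheses (ia : m1.-integrable setT (EFin \o a)) (ib : m2.-integrable setT (EFin \o b)).

Let ab (z : T1 * T2) := a z.1 * b z.2.

Let ma : measurable_fun setT a.
Proof. by apply/measurable_EFinP; exact: measurable_int ia. Qed.
Let mb : measurable_fun setT b.
Proof. by apply/measurable_EFinP; exact: measurable_int ib. Qed.

Let mab : measurable_fun setT ab.
Proof. by apply: measurable_funM; exact: measurableT_comp. Qed.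

Lemma integrable_prod : (m1 \x m2)%E.-integrable setT (EFin \o ab).
Proof.
apply/integrable12ltyP; first exact/measurable_EFinP.
rewrite (eq_integral (fun x => (\int[m2]_y `|b y|%:E) * `|a x|%:E)%E); last first.
  move=> x _ /=; rewrite muleC -integralZl //=.
    by apply: eq_integral => y _; rewrite /ab normrM EFinM.
  exact: (integrable_norm ib).
have bfin : (\int[m2]_y `|b y|%:E)%E \is a fin_num.
  have /integrableP[_] := ib; rewrite ge0_fin_numE //.
  by apply: integral_ge0 => y _; rewrite lee_fin.
rewrite -(fineK bfin) integralZl //; last exact: (integrable_norm ia).
have afin : (\int[m1]_x `|a x|%:E)%E \is a fin_num.
  have /integrableP[_] := ia; rewrite ge0_fin_numE //.
  by apply: integral_ge0 => y _; rewrite lee_fin.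
by rewrite -(fineK afin) -EFinM ltry.
Qed.

Lemma Rintegral_prod :
  \int[(m1 \x m2)%E]_z (a z.1 * b z.2) = (\int[m1]_x a x) * (\int[m2]_y b y).
Proof.
rewrite [LHS]/Rintegral -(integral12_prod_meas1 integrable_prod) /=.
have bfin : (\int[m2]_y (b y)%:E)%E \is a fin_num by exact: integrable_fin_num.
have afin : (\int[m1]_x (a x)%:E)%E \is a fin_num by exact: integrable_fin_num.
rewrite (eq_integral (fun x => (\int[m2]_y (b y)%:E) * (a x)%:E)%E); last first.
  by move=> x _ /=; rewrite muleC -integralZl.
by rewrite -(fineK bfin) integralZl // -(fineK afin) -EFinM mulrC.
Qed.

End ProductIntegral.

Section ComplexIntegral.
Context d (T : measurableType d) (K : realType) (mu : {measure set T -> \bar K}).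
Implicit Types f g : T -> K[i].

Definition cintegrable f :=
  mu.-integrable setT (EFin \o (fun t => complex.Re (f t))) /\
  mu.-integrable setT (EFin \o (fun t => complex.Im (f t))).

Let integrable_ReIm_lin f (u v : K) : cintegrable f ->
  mu.-integrable setT
    (EFin \o (fun t => u * complex.Re (f t) + v * complex.Im (f t))).
Proof.
move=> [f1 f2]; exact: (integrableD measurableT
  (integrableZl measurableT u f1) (integrableZl measurableT v f2)).
Qed.

Lemma cintegrable_lin z f g : cintegrable f -> cintegrable g ->
  cintegrable (fun t => z * f t + g t).
Proof.
case: z => x y [f1 f2] [g1 g2].
have h u v := integrable_ReIm_lin u v (conj f1 f2).
split.
  apply: (eq_integrable measurableT _ _ _ (integrableD measurableT (h x (- y)) g1)) => t _ /=.
  by case: (f t) (g t) => [? ?] [? ?] /=; rewrite mulNr EFinD.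
apply: (eq_integrable measurableT _ _ _ (integrableD measurableT (h y x) g2)) => t _ /=.
by case: (f t) (g t) => [? ?] [? ?] /=; rewrite EFinD (addrC (x * _)).
Qed.

Lemma cintegral_lin z f g : cintegrable f -> cintegrable g ->
  cintegral mu (fun t => z * f t + g t) = z * cintegral mu f + cintegral mu g.
Proof.
case: z => x y [f1 f2] [g1 g2].
have h u v := integrable_ReIm_lin u v (conj f1 f2).
have hE (u v : K) : \int[mu]_t (u * complex.Re (f t) + v * complex.Im (f t)) =
    u * \int[mu]_t complex.Re (f t) + v * \int[mu]_t complex.Im (f t).
  rewrite RintegralD //; first by rewrite !RintegralZl.
    exact: (integrableZl measurableT u f1).
  exact: (integrableZl measurableT v f2).
rewrite /cintegral; apply/eqP; rewrite eq_complex /=; apply/andP; split; apply/eqP.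
  rewrite -mulNr -hE -RintegralD //; apply: eq_Rintegral => t _.
  by case: (f t) (g t) => [? ?] [? ?] /=; rewrite mulNr.
rewrite [_ + y * _]addrC -hE -RintegralD //; apply: eq_Rintegral => t _.
by case: (f t) (g t) => [? ?] [? ?] /=; rewrite (addrC (x * _)).
Qed.

Lemma cintegrable0 : cintegrable (fun=> 0).
Proof. by split; exact: integrable0. Qed.

Lemma cintegral0 : cintegral mu (fun=> 0) = 0.
Proof. by rewrite /cintegral /Rintegral !integral0. Qed.

End ComplexIntegral.

Section ComplexProduct.
Context d1 d2 (T1 : measurableType d1) (T2 : measurableType d2) (K : realType).
Variables (m1 : {sigma_finite_measure set T1 -> \bar K}).
Variables (m2 : {sigma_finite_measure set T2 -> \bar K}).
Variables (f : T1 -> K[i]) (g : T2 -> K[i]).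
Hypotheses (hf : cintegrable m1 f) (hg : cintegrable m2 g).

Lemma cintegrable_prod : cintegrable (m1 \x m2)%E (fun z => f z.1 * g z.2).
Proof.
have [f1 f2] := hf; have [g1 g2] := hg; split.
  apply: (eq_integrable measurableT _ _ _ (integrableB measurableT
    (integrable_prod f1 g1) (integrable_prod f2 g2))) => z _ /=.
  by case: (f _) (g _) => [? ?] [? ?] /=; rewrite EFinB.
apply: (eq_integrable measurableT _ _ _ (integrableD measurableT
    (integrable_prod f1 g2) (integrable_prod f2 g1))) => z _ /=.
by case: (f _) (g _) => [? ?] [? ?] /=; rewrite EFinD.
Qed.

Lemma cintegral_prod :
  cintegral (m1 \x m2)%E (fun z => f z.1 * g z.2) = cintegral m1 f * cintegral m2 g.
Proof.
have [f1 f2] := hf; have [g1 g2] := hg.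
rewrite /cintegral; apply/eqP; rewrite eq_complex /=; apply/andP; split; apply/eqP.
  rewrite -!Rintegral_prod // -RintegralB //; last 2 first.
  - exact: (integrable_prod f1 g1).
  - exact: (integrable_prod f2 g2).
  by apply: eq_Rintegral => z _; case: (f _) (g _) => [? ?] [? ?].
rewrite -!Rintegral_prod // -RintegralD //; last 2 first.
- exact: (integrable_prod f1 g2).
- exact: (integrable_prod f2 g1).
by apply: eq_Rintegral => z _; case: (f _) (g _) => [? ?] [? ?].
Qed.

End ComplexProduct.

Section TupleProduct.
Context d (T : measurableType d) (K : realType).
Variable mu : {sigma_finite_measure set T -> \bar K}.

Let uncons n (t : n.+1.-tuple T) : T * n.-tuple T := (thead t, [tuple of behead t]).

Let unconsK n : cancel (@tuple_pcons _ T n) (@uncons n).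
Proof. by move=> [x t]; rewrite /uncons /tuple_pcons; congr pair; exact: val_inj. Qed.

Let measurable_uncons n : measurable_fun setT (@uncons n).
Proof.
apply/measurable_fun_pairP; split; first exact: measurable_tnth.
exact: measurable_behead.
Qed.

Lemma cintegral_tupleS n (nu : {sigma_finite_measure set (n.-tuple T) -> \bar K})
    (f : T -> K[i]) (g : n.-tuple T -> K[i]) :
  cintegrable mu f -> cintegrable nu g ->
  let h t := f (thead t) * g [tuple of behead t] in
  cintegrable (tuple_measureS mu nu) h /\
  cintegral (tuple_measureS mu nu) h = cintegral mu f * cintegral nu g.
Proof.
move=> hf hg h; pose fg z := f z.1 * g z.2.
have [r1 r2] := cintegrable_prod hf hg.
have mP := @measurable_tuple_pcons _ T n.
(* Change of variables for the image measure, the integrand being written through the inverse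
   [uncons] of [tuple_pcons]. *)
have key (q : T * n.-tuple T -> K) : (mu \x nu)%E.-integrable setT (EFin \o q) ->
    (tuple_measureS mu nu).-integrable setT (EFin \o (q \o @uncons n)) /\
    \int[tuple_measureS mu nu]_t (q (uncons t)) = \int[(mu \x nu)%E]_z q z.
  move=> iq.
  have mq : measurable_fun setT (EFin \o (q \o @uncons n)).
    apply: (@measurableT_comp _ _ _ _ _ _ (EFin \o q) setT (@uncons n)).
      exact: measurable_int iq.
    exact: measurable_uncons.
  have iq' : (mu \x nu)%E.-integrable (@tuple_pcons _ T n @^-1` setT)
      ((EFin \o (q \o @uncons n)) \o @tuple_pcons _ T n).
    rewrite preimage_setT (_ : _ \o _ = EFin \o q) //.
    by apply/funext => z /=; rewrite unconsK.
  split; first exact: (integrable_pushforward mP mq iq').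
  rewrite /Rintegral; congr fine.
  rewrite [LHS](integral_pushforward mP mq iq') // preimage_setT.
  by apply: eq_integral => z _ /=; rewrite unconsK.
have [k1 k1'] := key _ r1; have [k2 k2'] := key _ r2.
split; first by split.
rewrite -(cintegral_prod hf hg) /cintegral.
by congr (_ +i* _); [exact: k1' | exact: k2'].
Qed.

Lemma cintegral_tuple n (h : 'I_n -> T -> K[i]) :
  (forall i, cintegrable mu (h i)) ->
  let H t := \prod_i h i (tnth t i) in
  cintegrable (tuple_measure mu n) H /\
  cintegral (tuple_measure mu n) H = \prod_i cintegral mu (h i).
Proof.
elim: n h => [|n IHn] h hi.
  (* The empty product is integrated against a unit mass. *)
  have H1 : (fun t : 0.-tuple T => \prod_i h i (tnth t i)) = (fun=> 1).
    by apply/funext => t; rewrite big_ord0.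
  rewrite big_ord0 /= H1; split.
    by split; exact: finite_measure_integrable_cst.
  by rewrite /cintegral /Rintegral !integral_dirac //= indicT mulr1 mulr0.
have [ih ihE] := IHn (fun i => h (lift ord0 i)) (fun i => hi _).
have [k kE] := cintegral_tupleS (hi ord0) ih.
rewrite big_ord_recl /= -ihE -kE.
have HE : (fun t : n.+1.-tuple T => \prod_i h i (tnth t i)) =
    (fun t => h ord0 (thead t) * \prod_(i < n) h (lift ord0 i) (tnth [tuple of behead t] i)).
  apply/funext => t; rewrite big_ord_recl; congr (_ * _).
  apply: eq_bigr => i _; congr (h _ _).
  by rewrite [t in LHS]tuple_eta tnthS.
by rewrite HE.
Qed.
End TupleProduct.

Lemma polyCC_sqrN1 (A : comNzRingType) (i : A) :
  i ^+ 2 = -1 -> (i%:P)%:P * (i%:P)%:P = -1 :> {poly {poly A}}.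
Proof. by move=> i2; rewrite -!polyCM -expr2 i2 !polyCN. Qed.

Lemma polyCC_natr (A : comNzRingType) n : (n%:R%:P)%:P = n%:R :> {poly {poly A}}.
Proof. by rewrite !polyC_natr. Qed.

(** * Moments of the complex Gaussian by integration by parts *)

Section PlaneMoments.
Variable K : realType.
Notation C := K[i].
Let mu : {sigma_finite_measure set (measurableTypeR K) -> \bar K} := @lebesgue_measure K.

Lemma gauss_complexE (p : {poly C}) (r : K) : (gauss_fun r)%:C * p.[r%:C] =
  ((\poly_(i < size p) complex.Re p`_i).[r] * gauss_fun r) +i*
  ((\poly_(i < size p) complex.Im p`_i).[r] * gauss_fun r).
Proof.
have -> : p.[r%:C] = (\poly_(i < size p) complex.Re p`_i).[r] +i*
                      (\poly_(i < size p) complex.Im p`_i).[r].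
  rewrite horner_coef !horner_poly.
  elim/big_rec3: _ => // i x y z _ ->.
  rewrite -rmorphXn /=; case: (p`_i) => u v /=.
  by apply/eqP; rewrite eq_complex /= !mulr0 subr0 add0r !eqxx.
by apply/eqP; rewrite eq_complex /= !mul0r subr0 addr0 ![gauss_fun r * _]mulrC !eqxx.
Qed.

Lemma cintegrable_gauss (p : {poly C}) :
  cintegrable mu (fun r => (gauss_fun r)%:C * p.[r%:C]).
Proof.
by split; (apply: eq_integrable (integrable_poly_gauss _) => //;
  last by move=> r _ /=; rewrite gauss_complexE).
Qed.

Definition gauss1 (p : {poly C}) : C :=
  cintegral mu (fun r => (gauss_fun r)%:C * p.[r%:C]).

Lemma gauss1_is_scalar : scalar gauss1.
Proof.
move=> z p q; rewrite /gauss1 -cintegral_lin; [|exact: cintegrable_gauss|exact: cintegrable_gauss].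
congr (cintegral mu _); apply/funext => r; by rewrite !hornerE /= mulrDr mulrCA mulrA.
Qed.

HB.instance Definition _ := GRing.isLinear.Build C {poly C} C *%R gauss1 gauss1_is_scalar.

Lemma gauss1_real (p : {poly K}) :
  gauss1 (map_poly (real_complex K) p) = (\int[mu]_r (p.[r] * gauss_fun r))%:C.
Proof.
rewrite /gauss1 /cintegral; congr (_ +i* _).
  by apply: eq_Rintegral => r _; rewrite horner_map -rmorphM /= mulrC.
rewrite /Rintegral integral0_eq // => r _.
by rewrite horner_map -rmorphM.
Qed.

(** By linearity a power of ['X] suffices; its integral is real, and [poly_gauss_by_parts]
    applies. *)
Lemma gauss1_X (p : {poly C}) : gauss1 ('X * p) = 2^-1 * gauss1 p^`().
Proof.
rewrite -[p]coefK poly_def mulr_sumr raddf_sum.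
rewrite !linear_sum mulr_sumr /=; apply: eq_bigr => k _.
rewrite derivZ -scalerAr !linearZ /= [2^-1 * _]mulrCA; congr (_ * _).
have := congr1 (real_complex K) (@poly_gauss_by_parts K 'X^k).
rewrite -gauss1_real rmorph0 rmorphB !rmorphM /= map_polyX map_polyXn.
rewrite -deriv_map map_polyXn raddfB /= => /eqP; rewrite subr_eq0 => /eqP ->.
rewrite map_polyC /= -mulrA mul_polyC linearZ /= mulrA.
rewrite (_ : (real_complex K 2) = 2) ?rmorph_nat // mulVf ?mul1r //.
Qed.

Lemma gauss1_1 : gauss1 1 = (Num.sqrt pi)%:C.
Proof.
rewrite -(rmorph1 (map_poly (real_complex K))) gauss1_real; congr (_ %:C).
transitivity (fine (Num.sqrt pi : K)%:E) => //.
rewrite /Rintegral -integralT_gauss; congr fine; apply: eq_integral => x _.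
by rewrite hornerC mul1r.
Qed.

(** An iterated integral: first over the inner variable, coefficient by coefficient, then over the
    outer one. [cintegral_plane] identifies it with the integral over the plane. *)
Definition gauss2 (P : {poly {poly C}}) : C := gauss1 (map_poly gauss1 P).

Lemma gauss2D P Q : gauss2 (P + Q) = gauss2 P + gauss2 Q.
Proof. by rewrite /gauss2 !raddfD. Qed.

Lemma gauss2Z z P : gauss2 (z%:P *: P) = z * gauss2 P.
Proof.
transitivity (gauss1 (z *: map_poly gauss1 P)); last by rewrite linearZ.
rewrite /gauss2; congr gauss1; apply/polyP => k.
by rewrite coef_map !coefZ coef_map mul_polyC /= linearZ.
Qed.

Lemma gauss2_X P : gauss2 ('X * P) = 2^-1 * gauss2 P^`().
Proof.
rewrite /gauss2 (_ : map_poly gauss1 P^`() = (map_poly gauss1 P)^`()).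
  rewrite -gauss1_X; congr gauss1; apply/polyP => k.
  by rewrite coef_map !coefXM coef_map; case: eqP => //; rewrite raddf0.
by apply/polyP => k; rewrite coef_map !coef_deriv coef_map raddfMn.
Qed.

Lemma gauss2_Y P : gauss2 ('X%:P * P) = 2^-1 * gauss2 (map_poly deriv P).
Proof.
transitivity (gauss1 (2^-1 *: map_poly gauss1 (map_poly deriv P))); last by rewrite linearZ.
rewrite /gauss2; congr gauss1; apply/polyP => k.
by rewrite coef_map coefCM coefZ coef_map coef_map /= gauss1_X.
Qed.

Lemma map_derivM (P Q : {poly {poly C}}) :
  map_poly deriv (P * Q) = map_poly deriv P * Q + P * map_poly deriv Q.
Proof.
apply/polyP => k; rewrite coef_map !coefM coefD !coefM raddf_sum -big_split.
by apply: eq_bigr => i _; rewrite !coef_map /= derivM.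
Qed.

Lemma derivation_expX (A : comNzRingType) (D : A -> A) :
  (forall u v, D (u * v) = D u * v + u * D v) ->
  forall u n, D (u ^+ n) = n%:R * u ^+ n.-1 * D u.
Proof.
move=> DM u; have D1 : D 1 = 0.
  by have := DM 1 1; rewrite !mulr1 mul1r -[X in X = _]addr0 => /addrI.
elim=> [|[|n] IHn]; first by rewrite expr0 !mul0r.
  by rewrite expr1 mulr1 mul1r.
rewrite exprS DM IHn /= -[in RHS]natr1 exprS; ring.
Qed.

(* [z = x + i y] and its conjugate, with [x] the outer variable and [y] the inner
   one. *)
Let zP : {poly {poly C}} := 'X + ('i *: 'X)%:P.
Let wP : {poly {poly C}} := 'X - ('i *: 'X)%:P.

Let dzP : zP^`() = 1. Proof. by rewrite /zP derivD derivX derivC addr0. Qed.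
Let dwP : wP^`() = 1. Proof. by rewrite /wP derivB derivX derivC subr0. Qed.
Let DzP : map_poly deriv zP = ('i%:P)%:P.
Proof.
apply/polyP => k; rewrite coef_map coefD coefX !coefC.
case: k => [|[|k]] /=; rewrite ?add0r ?addr0 ?derivZ ?derivX ?raddf0 ?derivC //.
by rewrite alg_polyC.
Qed.
Let DwP : map_poly deriv wP = - ('i%:P)%:P.
Proof.
apply/polyP => k; rewrite coef_map coefB coefN coefX !coefC.
case: k => [|[|k]] /=; rewrite ?sub0r ?subr0 ?derivN ?derivZ ?derivX ?raddf0 ?derivC //.
  by rewrite alg_polyC.
Qed.

(** Integration by parts in both variables. For [c = 'i] the operator applied to [G] is twice the
    derivative in the conjugate of [z], for [c = - 'i] twice the derivative in [z]. *)
Lemma gauss2_lin c (G : {poly {poly C}}) :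
  gauss2 (('X + (c *: 'X)%:P) * G) = 2^-1 * gauss2 (G^`() + c%:P *: map_poly deriv G).
Proof.
rewrite mulrDl !gauss2D gauss2_X gauss2Z mulrDr; congr (_ + _).
by rewrite -mul_polyC polyCM -mulrA mul_polyC gauss2Z gauss2_Y mulrCA.
Qed.

Lemma polyCC_i_mul : ('i%:P)%:P * ('i%:P)%:P = -1 :> {poly {poly C}}.
Proof. exact: (polyCC_sqrN1 (sqr_i K)). Qed.

Lemma derivation_zw (D : {poly {poly C}} -> {poly {poly C}}) u v a b :
  (forall P Q, D (P * Q) = D P * Q + P * D Q) -> D zP = u -> D wP = v ->
  D (zP ^+ a * wP ^+ b) = a%:R * (zP ^+ a.-1 * wP ^+ b) * u +
                          b%:R * (zP ^+ a * wP ^+ b.-1) * v.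
Proof.
move=> DM Du Dv; rewrite DM !(derivation_expX DM) Du Dv.
move: (zP ^+ a) (zP ^+ a.-1) (wP ^+ b) (wP ^+ b.-1) => A A' B B'.
by ring.
Qed.

(** Since ['i ^+ 2 = -1], the operator for [c = 'i] kills [zP] and sends [wP] to [2], which cancels
    the factor [2^-1]. *)
Lemma gauss2_z a b : gauss2 (zP * (zP ^+ a * wP ^+ b)) =
  b%:R * gauss2 (zP ^+ a * wP ^+ b.-1).
Proof.
rewrite [LHS](gauss2_lin 'i) -mul_polyC.
rewrite (derivation_zw _ _ (@derivM _) dzP dwP) (derivation_zw _ _ map_derivM DzP DwP).
move: (zP ^+ a.-1 * wP ^+ b) (zP ^+ a * wP ^+ b.-1) => A B.
rewrite [X in gauss2 X](_ : _ = (b * 2)%:R%:P *: B).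
  by rewrite gauss2Z natrM mulrA; congr (_ * _); rewrite mulrC mulfK // pnatr_eq0.
rewrite -mul_polyC polyCC_natr natrM.
have := polyCC_i_mul; move: (('i%:P)%:P : {poly {poly C}}) => I II.
by ring: II.
Qed.

(** The operator for [c = - 'i] kills [wP]. *)
Lemma gauss2_w b : gauss2 (wP * wP ^+ b) = 0.
Proof.
have wE : wP = 'X + ((- 'i) *: 'X)%:P by rewrite /wP scaleNr polyCN.
rewrite {1}wE gauss2_lin -mul_polyC.
rewrite (derivation_expX (@derivM _)) (derivation_expX map_derivM) dwP DwP.
move: (b%:R * wP ^+ b.-1) => B.
rewrite [X in gauss2 X](_ : _ = 0).
  by rewrite /gauss2 !raddf0 mulr0.
rewrite (polyCN 'i) (polyCN 'i%:P).
have := polyCC_i_mul; move: (('i%:P)%:P : {poly {poly C}}) => I II.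
by ring: II.
Qed.

(** Removing one [zP] removes one [wP]. Unequal exponents end in [gauss2_w] or in a factor [0],
    equal ones in the total mass [pi], the square of the one-dimensional integral. *)
Lemma gauss2_moment a b : gauss2 (zP ^+ a * wP ^+ b) = cgauss_moment C a b * pi%:C.
Proof.
elim: a b => [|a IHa] [|b].
- rewrite !expr0 mulr1 /cgauss_moment eqxx mul1r.
  rewrite /gauss2 (_ : map_poly gauss1 1 = gauss1 1 *: 1).
    rewrite linearZ /= gauss1_1 -rmorphM /= -expr2 sqr_sqrtr ?pi_ge0 //.
  apply/polyP => k; rewrite coef_map coefZ !coef1.
  by case: eqP; rewrite ?mulr1 ?mulr0 ?raddf0.
- by rewrite expr0 mul1r exprS gauss2_w mul0r.
- by rewrite exprS -mulrA gauss2_z !mul0r.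
rewrite exprS -mulrA gauss2_z IHa /cgauss_moment eqSS mulrA; congr (_ * _).
by case: eqP => [->|]; rewrite ?mulr0 // factS natrM.
Qed.

End PlaneMoments.

Section Plane.
Variable K : realType.
Notation C := K[i].
Let mu : {sigma_finite_measure set (measurableTypeR K) -> \bar K} := @lebesgue_measure K.

Definition plane_weight (P : {poly {poly C}})
    (z : measurableTypeR K * measurableTypeR K) : C :=
  (gauss_fun z.1 * gauss_fun z.2)%:C * (P.[(z.1%:C)%:P]).[z.2%:C].

(** Fubini for each power of the outer variable times its coefficient, then linearity, which needs
    the integrability proved alongside. *)
Lemma cintegral_plane (P : {poly {poly C}}) :
  cintegrable (mu \x mu)%E (plane_weight P) /\
  cintegral (mu \x mu)%E (plane_weight P) = gauss2 P.
Proof.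
rewrite -[P]coefK poly_def; elim/big_rec: _ => [|k Q _ [IH1 IH2]].
  have -> : plane_weight 0 = fun=> 0.
    by apply/funext => z; rewrite /plane_weight !horner0 mulr0.
  by rewrite /gauss2 !raddf0; split; [exact: cintegrable0 | exact: cintegral0].
pose f (r : measurableTypeR K) : C := (gauss_fun r)%:C * ('X^k : {poly C}).[r%:C].
pose g (r : measurableTypeR K) : C := (gauss_fun r)%:C * (P`_k).[r%:C].
have fi : cintegrable mu f by exact: cintegrable_gauss.
have gi : cintegrable mu g by exact: cintegrable_gauss.
have E : plane_weight (P`_k *: 'X^k + Q) =
    fun z => 1 * (f z.1 * g z.2) + plane_weight Q z.
  apply/funext => z; rewrite /plane_weight hornerD hornerD mulrDr; congr (_ + _).
  rewrite hornerZ hornerXn hornerM -rmorphXn hornerC mul1r /f /g hornerXn rmorphM.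
  by rewrite [X in _ * X]mulrC mulrACA.
have fg := cintegrable_prod fi gi.
rewrite E; split; first exact: cintegrable_lin.
transitivity (1 * cintegral (mu \x mu)%E (fun z => f z.1 * g z.2) +
              cintegral (mu \x mu)%E (plane_weight Q)).
  exact: (cintegral_lin 1 fg IH1).
rewrite IH2 mul1r gauss2D; congr (_ + _).
rewrite (cintegral_prod fi gi).
rewrite /gauss2 (_ : map_poly _ _ = gauss1 P`_k *: 'X^k).
  by rewrite linearZ /= mulrC.
apply/polyP => j; rewrite coef_map !coefZ !coefXn /=.
by case: eqP => _; rewrite ?mulr1 ?mulr0 ?raddf0.
Qed.

Definition plane_monomial (a b : nat) (z : measurableTypeR K * measurableTypeR K) : C :=
  (gauss_fun z.1 * gauss_fun z.2)%:C * ((z.1 +i* z.2) ^+ a * ((z.1 +i* z.2)^*)%R ^+ b).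

Lemma cintegral_plane_monomial a b :
  cintegrable (@lebesgue_measure2 K) (plane_monomial a b) /\
  cintegral (@lebesgue_measure2 K) (plane_monomial a b) = cgauss_moment C a b * pi%:C.
Proof.
rewrite -gauss2_moment.
suff -> : plane_monomial a b =
   plane_weight (('X + ('i *: 'X)%:P) ^+ a * ('X - ('i *: 'X)%:P) ^+ b).
  exact: cintegral_plane.
apply/funext => z; rewrite /plane_monomial /plane_weight; congr (_ * _).
rewrite hornerM !horner_exp hornerM !horner_exp; congr (_ ^+ _ * _ ^+ _).
  rewrite hornerD hornerX hornerC hornerD hornerC hornerZ hornerX.
  by apply/eqP; rewrite eq_complex /=; apply/andP; split; apply/eqP; ring.
rewrite hornerD hornerX hornerN hornerC hornerD hornerN hornerC hornerZ hornerX.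
by apply/eqP; rewrite eq_complex /=; apply/andP; split; apply/eqP; ring.
Qed.

End Plane.

(** * From expectations to integrals over triangular matrices *)

Section Triangular.
Variables (K : realType) (n : nat).
Notation C := K[i].
Let N := #|{: upper_index n}|.

(** Any commutative law is allowed, so that products of moments and the sum in the trace are both
    covered. *)
Lemma big_upper_index (A : Type) (idx : A) (op : Monoid.com_law idx)
    (F : 'I_n -> 'I_n -> A) :
  \big[op/idx]_(j < n) \big[op/idx]_(i < n | (i < j)%N) F i j =
  \big[op/idx]_(r < N) F (val (enum_val r)).1 (val (enum_val r)).2.
Proof.
rewrite pair_big_dep /=.
rewrite (reindex_omap (fun r : 'I_N => ((val (enum_val r)).2, (val (enum_val r)).1))
  (fun p => omap (fun e : upper_index n => enum_rank e) (insub (p.2, p.1)))); last first.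
  move=> [j i] /= ij; case: insubP => [e _ eE|]; last by rewrite ij.
  by rewrite /= enum_rankK -[sval e]/(val e) eE.
apply: eq_bigl => r /=; rewrite -surjective_pairing valK /= enum_valK eqxx andbT.
exact: (valP (enum_val r)).
Qed.

Definition upper_fun (T : 'M[C]_n) (i j : nat) : C :=
  if insub i is Some i then if insub j is Some j then T i j else 0 else 0.

Lemma upper_funE T (i j : 'I_n) : upper_fun T i j = T i j.
Proof. by rewrite /upper_fun !valK. Qed.

Let coord (t : N.-tuple (measurableTypeR K * measurableTypeR K)) r : C :=
  (tnth t r).1 +i* (tnth t r).2.

Lemma triangular_mxE (t : N.-tuple (measurableTypeR K * measurableTypeR K)) r :
  triangular_mx t (val (enum_val r)).1 (val (enum_val r)).2 = coord t r.
Proof. by rewrite mxE -surjective_pairing valK enum_valK. Qed.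

Lemma triangular_mx0 (t : N.-tuple (measurableTypeR K * measurableTypeR K)) (i j : 'I_n) :
  (j <= i)%N -> triangular_mx t i j = 0.
Proof. by move=> ji; rewrite mxE; case: insubP => // e /=; rewrite ltnNge ji. Qed.

(** The trace is the sum of the squared moduli of the entries, so the weight factors over the real
    coordinates. *)
Lemma gauss_weightE (t : N.-tuple (measurableTypeR K * measurableTypeR K)) :
  gauss_weight (triangular_mx t) =
  \prod_(r < N) (gauss_fun (tnth t r).1 * gauss_fun (tnth t r).2).
Proof.
pose T := triangular_mx t.
have trE : complex.Re (\tr (T *m (map_mx Num.conj T^T))) =
    \sum_(r < N) ((tnth t r).1 ^+ 2 + (tnth t r).2 ^+ 2).
  rewrite /mxtrace.
  under eq_bigr => i _ do rewrite mxE.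
  rewrite exchange_big /=.
  have sq (z : C) : z * z^* %R = (complex.Re z ^+ 2 + complex.Im z ^+ 2)%:C.
    case: z => u v; apply/eqP; rewrite eq_complex /=.
    by apply/andP; split; apply/eqP; ring.
  transitivity (complex.Re (\sum_(j < n) \sum_(i < n | (i < j)%N)
     (complex.Re (T i j) ^+ 2 + complex.Im (T i j) ^+ 2)%:C : C)).
    congr complex.Re; apply: eq_bigr => j _; rewrite [RHS]big_mkcond /=.
    apply: eq_bigr => i _; rewrite [map_mx _ _ _ _]mxE [T^T _ _]mxE sq.
    case: ltnP => // ji; rewrite [T i j]triangular_mx0 //=.
    by rewrite !expr0n /= addr0.
  rewrite big_upper_index -rmorph_sum /=; apply: eq_bigr => r _.
  by rewrite triangular_mxE.
rewrite /gauss_weight trE -sumrN expR_sum; apply: eq_bigr => r _.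
by rewrite /gauss_fun -expRD opprD.
Qed.

Let tri_integrand (phi : (nat -> nat -> C) -> C)
    (t : N.-tuple (measurableTypeR K * measurableTypeR K)) : C :=
  (gauss_weight (triangular_mx t))%:C * phi (upper_fun (triangular_mx t)).

Lemma tri_monomial_integrand al be t :
  tri_integrand (tri_monomial n al be) t =
  \prod_(r < N) plane_monomial (al (val (enum_val r)).1 (val (enum_val r)).2)
     (be (val (enum_val r)).1 (val (enum_val r)).2) (tnth t r).
Proof.
rewrite /tri_integrand gauss_weightE rmorph_prod /tri_monomial.
rewrite (big_upper_index _ (fun i j => upper_fun (triangular_mx t) i j ^+ al i j *
   (upper_fun (triangular_mx t) i j)^* %R ^+ be i j)) -big_split /=.
by apply: eq_bigr => r _; rewrite upper_funE triangular_mxE.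
Qed.

(** The link between algebra and analysis, by induction on the derivation. For a monomial the
    integrand is a product over the coordinates, each contributing its moment times [pi]. *)
Lemma cintegral_gauss_expect phi c : gauss_expect n phi c ->
  cintegrable (triangular_measure K n) (tri_integrand phi) /\
  cintegral (triangular_measure K n) (tri_integrand phi) = c * (pi ^+ N)%:C.
Proof.
elim=> {phi c} [al be||z phi c psi d _ [p1 p2] _ [q1 q2]|phi psi c e _ [IH1 IH2]].
- have -> : tri_integrand (tri_monomial n al be) = fun t =>
     \prod_(r < N) plane_monomial (al (val (enum_val r)).1 (val (enum_val r)).2)
     (be (val (enum_val r)).1 (val (enum_val r)).2) (tnth t r).
    by apply/funext => t; exact: tri_monomial_integrand.
  have [] := @cintegral_tuple _ _ K (@lebesgue_measure2 K) N
    (fun r => plane_monomial (al (val (enum_val r)).1 (val (enum_val r)).2)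
     (be (val (enum_val r)).1 (val (enum_val r)).2))
    (fun r => proj1 (cintegral_plane_monomial K _ _)).
  move=> h1 h2; split; first exact: h1.
  rewrite h2 /tri_moment (big_upper_index _ (fun i j => cgauss_moment C (al i j) (be i j))).
  under eq_bigr => r _ do rewrite (proj2 (cintegral_plane_monomial K _ _)).
  by rewrite big_split /= prodr_const card_ord rmorphXn.
- have -> : tri_integrand (fun=> 0) = fun=> 0.
    by apply/funext => t; rewrite /tri_integrand mulr0.
  by split; [exact: cintegrable0 | rewrite mul0r; exact: cintegral0].
- have -> : tri_integrand (fun t => z * phi t + psi t) =
      fun t => z * tri_integrand phi t + tri_integrand psi t.
    by apply/funext => t; rewrite /tri_integrand mulrDr mulrCA.
  split; first exact: cintegrable_lin.
  rewrite mulrDl -mulrA -p2 -q2; exact: cintegral_lin.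
have <- : tri_integrand phi = tri_integrand psi.
  by apply/funext => t; rewrite /tri_integrand e.
by split.
Qed.

Lemma triangular_total_mass :
  \int[triangular_measure K n]_t gauss_weight (triangular_mx t) = pi ^+ N.
Proof.
have [_] := cintegral_gauss_expect
  (gauss_expect_monomial C n (fun _ _ => 0%N) (fun _ _ => 0%N)).
rewrite /tri_moment big1 => [|j _]; last by rewrite big1.
rewrite mul1r => /(congr1 (@complex.Re K)) /= <-.
apply: eq_Rintegral => t _; rewrite /tri_integrand /tri_monomial big1 ?mulr1 // => j _.
by rewrite big1 // => i _; rewrite !expr0 mulr1.
Qed.

Lemma pi_exp_neq0 : (pi ^+ N)%:C != 0 :> C.
Proof.
rewrite -(rmorph0 (real_complex K)) (inj_eq (@complexI K)).
by rewrite expf_neq0 // gt_eqF // pi_gt0.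
Qed.

(** The integral depends on [phi] alone and determines the value, as [pi ^+ N] is nonzero. *)
Lemma gauss_expect_uniq (phi : (nat -> nat -> C) -> C) (c d : C) :
  gauss_expect n phi c -> gauss_expect n phi d -> c = d.
Proof.
move=> /cintegral_gauss_expect[_ h1] /cintegral_gauss_expect[_ h2].
by apply: (mulIf pi_exp_neq0); rewrite -h1 -h2.
Qed.

End Triangular.

(** * Matching the recursion with the matrix product and with [F] *)

Section Conclusion.
Variables (K : realType) (R : nat) (x y : 'I_R -> K[i]).
Notation C := K[i].

(** The outermost step of the recursion uses the last diagonal entries, hence is the leftmost
    factor. *)
Lemma F_value_calM (X Y : nat -> C) p' n p :
  F_value x y X Y p' n p =
  (\prod_(k < n) calM x y (X (n - k.+1)%N) (Y (n - k.+1)%N)) (enum_rank p) (enum_rank p').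
Proof.
elim: n p => [|n IHn] p; first by rewrite big_ord0 /= mxE (inj_eq enum_rank_inj).
rewrite big_ord_recl -mulmxE mxE /= subn1 /=.
rewrite (reindex enum_rank) /=; last by apply: onW_bij; exact: enum_rank_bij.
apply: eq_bigr => q _; rewrite mxE !enum_rankK IHn; congr (_ * _).
Qed.

Variables (n : nat) (X Y : 'rV[C]_n).
Hypotheses (xX : forall i k, x i != X ord0 k) (yY : forall i k, y i != Y ord0 k).

Definition nat_row (Z : 'rV[C]_n) (k : nat) : C :=
  if insub k is Some k then Z ord0 k else 0.

Lemma nat_rowE (Z : 'rV[C]_n) (k : 'I_n) : nat_row Z k = Z ord0 k.
Proof. by rewrite /nat_row valK. Qed.

(** The first matrix is upper triangular, the second is the transpose of an upper triangular one
    with conjugated entries; [res_entry] describes both resolvents, and [tr_sum_cycles] applies. *)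
Lemma F_eq_F_poly (p p' : 'S_R) t :
  let T := triangular_mx t in
  F p p' x y (diag_mx X + T) (diag_mx Y + map_mx Num.conj T^T) =
  F_poly x y (nat_row X) (nat_row Y) p' n p (upper_fun T).
Proof.
move=> T; have finj : injective (cycle_step p p') by move=> i j /perm_inj /perm_inj.
pose tb i j := ((upper_fun T i j)^*)%R.
have AE : diag_mx X + T = upper_mx n (nat_row X) (upper_fun T).
  apply/matrixP => i j; rewrite [LHS]mxE [diag_mx X _ _]mxE [RHS]mxE.
  rewrite upper_funE nat_rowE -!val_eqE /=.
  case: ltngtP => [ij|ji|/val_inj ->].
  - by rewrite mulr0n add0r.
  - by rewrite mulr0n add0r triangular_mx0 // ltnW.
  - by rewrite mulr1n triangular_mx0 // addr0.
have BE : diag_mx Y + map_mx Num.conj T^T = (upper_mx n (nat_row Y) tb)^T.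
  apply/matrixP => i j; rewrite [LHS]mxE [diag_mx Y _ _]mxE [map_mx _ _ _ _]mxE [T^T _ _]mxE.
  rewrite [RHS]mxE [RHS]mxE /tb upper_funE nat_rowE [i == j]eq_sym -!val_eqE /=.
  case: ltngtP => [ji|ij|/val_inj ->].
  - by rewrite mulr0n add0r.
  - by rewrite mulr0n add0r triangular_mx0 ?rmorph0 // ltnW.
  - by rewrite mulr1n triangular_mx0 // rmorph0 addr0.
rewrite AE BE /F_poly.
rewrite (tr_sum_cycles (f := cycle_step p p')
  (P := fun i => resolvent (x i) (upper_mx n (nat_row X) (upper_fun T)))
  (Q := fun i => resolvent (y (p i)) (upper_mx n (nat_row Y) tb)^T)) //.
  move=> i; rewrite /resolvent res_entryP // => k kn.
  by rewrite -[k]/(val (Ordinal kn)) nat_rowE.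
move=> i; rewrite /resolvent -(tr_scalar_mx _ (y (p i))) -raddfB -trmx_inv res_entryP.
  by apply/matrixP => k l; rewrite !mxE.
by move=> k kn; rewrite -[k]/(val (Ordinal kn)) nat_rowE.
Qed.

End Conclusion.

Theorem theorem5p2 (K : realType) (n R : nat) (n_gt0 : (0 < n)%N)
    (R_gt0 : (0 < R)%N) (x y : 'I_R -> K[i]) (X Y : 'rV[K[i]]_n)
    (xX : forall i k, x i != X ord0 k) (yY : forall i k, y i != Y ord0 k)
    (p p' : 'S_R) :
  W p p' x y (diag_mx X) (diag_mx Y) =
  (\prod_(k < n)
     calM x y (X ord0 (rev_ord k)) (Y ord0 (rev_ord k)))
    (enum_rank p) (enum_rank p').
Proof.
have := gauss_expect_F x y (nat_row X) (nat_row Y) p' (@gauss_expect_uniq K) n p.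
move=> /cintegral_gauss_expect [_ WE].
have -> : \prod_(k < n) calM x y (X ord0 (rev_ord k)) (Y ord0 (rev_ord k)) =
    \prod_(k < n) calM x y (nat_row X (n - k.+1)) (nat_row Y (n - k.+1)).
  by apply: eq_bigr => k _; rewrite -!nat_rowE.
rewrite -F_value_calM /W triangular_total_mass.
(* The numerator carries the factor [pi ^+ N] too, and it cancels. *)
apply: (canLR (mulfK (pi_exp_neq0 K n))); rewrite -WE.
congr cintegral; apply/funext => t; congr (_ * _).
exact: F_eq_F_poly.
Qed.
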